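(* Let $F_1,F_2\in\mathbb{K}[X_1,X_2,X_3]$ be quadratic forms without common factors such that $(0:0:1)\in V(F_1,F_2)$ and $T_1F_2(X)-T_2F_1(X)$ defines a nondegenerate conic in $\mathbb{P}^2_{\overline{\mathbb{K}(T_1,T_2)}}$. Let $a(T),b(T)\in\mathbb{K}[T_1,T_2]$ be homogeneous of the same degree $d_0>2$ without common factors. Then the polynomial $a(F_1,F_2)X_2-b(F_1,F_2)X_1\in\mathbb{K}[X_1,X_2,X_3]$ either is irreducible or has a unique irreducible factor of degree larger than $1$. In both cases, this irreducible factor defines a rational curve $C\subset\mathbb{P}^2$ which is parameterizable by $(F_1,F_2)$ and passes through $(0:0:1)$. The extraneous factor, i.e. the quotient of $a(F_1,F_2)X_2-b(F_1,F_2)X_1$ by this irreducible factor, is a product of linear factors each defining a line passing through at least one point of $V(F_1,F_2)$, and its degree is less than or equal to three.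
   Context: $\mathbb{K}$ is an algebraically closed field, $X=(X_1,X_2,X_3)$, $T=(T_1,T_2)$, and $V(F_1,F_2)\subset\mathbb{P}^2$ is the set of common zeros of $F_1,F_2$. A conic over the algebraically closed field $\overline{\mathbb{K}(T_1,T_2)}$ is degenerate if its quadratic form is a product of two linear forms over that field; otherwise it is nondegenerate. For homogeneous $F_1,F_2\in\mathbb{K}[X]$ of the same degree and without common factors, a curve $C\subset\mathbb{P}^2$ (zero locus of an irreducible homogeneous polynomial) is parameterizable by $(F_1,F_2)$ if the rational map $\psi:C\dashrightarrow\mathbb{P}^1$, $x\mapsto(F_1(x):F_2(x))$, is birational with inverse a map $\phi:\mathbb{P}^1\to C$ given by three homogeneous polynomials in $\mathbb{K}[T_1,T_2]$ of the same degree without common factors. *)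

(* Defs.v *)
From HB Require Import structures.
From mathcomp Require Import all_boot all_order all_algebra.
From mathcomp.multinomials Require Export mpoly.

Set Implicit Arguments.
Unset Strict Implicit.
Unset Printing Implicit Defensive.

Import GRing.Theory.
Local Open Scope ring_scope.

Section Divisibility.

Variable R : comUnitRingType.
Implicit Types d p q u : R.

Definition divides d p : Prop := exists q, p = d * q.

Definition irreducible_elt p : Prop :=
  [/\ p != 0, p \isn't a GRing.unit &
      forall u v : R, p = u * v -> u \is a GRing.unit \/ v \is a GRing.unit].

Definition associates p q : Prop :=
  exists2 u, u \is a GRing.unit & p = u * q.

Definition no_common_factor (s : seq R) : Prop :=
  forall d, {in s, forall p, divides d p} -> d \is a GRing.unit.

End Divisibility.

(* [msize p] is the total degree of [p] plus one, and [msize 0 = 0]. *)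
Definition unique_nonlinear_factor (R : idomainType) (n : nat)
    (P G : {mpoly R[n]}) : Prop :=
  [/\ irreducible_elt G, divides G P, (2 < msize G)%N &
      forall H : {mpoly R[n]}, irreducible_elt H -> divides H P ->
        (2 < msize H)%N -> associates H G].

Definition linear_form (R : idomainType) (n : nat) (l : {mpoly R[n]}) : Prop :=
  l \is 1.-homog.

(* A quadratic form [Q] over an algebraically closed field. *)
Definition degenerate_conic (L : closedFieldType) (Q : {mpoly L[3]}) : Prop :=
  exists l1 l2 : {mpoly L[3]},
    [/\ linear_form l1, linear_form l2 & Q = l1 * l2].

Definition is_algebraic_closure (F : fieldType) (L : closedFieldType)
    (iota : {rmorphism F -> L}) : Prop :=
  forall x : L, algebraicOver iota x.

Section Pencil.

Variables (K : fieldType) (L : closedFieldType).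
Variable iota : {rmorphism {fraction {mpoly K[2]}} -> L}.

Definition pencil_T (i : 'I_2) : L := iota (tofrac ('X_i : {mpoly K[2]})).

Definition pencil_base_change : {mpoly K[3]} -> {mpoly L[3]} :=
  map_mpoly (fun c : K => iota (tofrac (c%:MP_[2]))).

(* T1 F2 - T2 F1 as a form in X1, X2, X3 over L. *)
Definition pencil_conic (F1 F2 : {mpoly K[3]}) : {mpoly L[3]} :=
  pencil_T 0 *: pencil_base_change F2 - pencil_T 1 *: pencil_base_change F1.

End Pencil.

(* Points of P^(n-1) are represented by nonzero row vectors of length n, and a
   projective subset is given by a scaling-invariant condition on them. *)
Section PlaneCurves.

Variable K : closedFieldType.

Definition proj_eq (n : nat) (x y : 'rV[K]_n) : Prop :=
  [/\ x != 0, y != 0 & exists c : K, x = c *: y].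

Definition vanishes_at (n : nat) (p : {mpoly K[n]}) (x : 'rV[K]_n) : Prop :=
  p.@[x 0] = 0.

Definition map_at (m n : nat) (f : m.-tuple {mpoly K[n]}) (x : 'rV[K]_n) :
    'rV[K]_m := \row_i (tnth f i).@[x 0].

(* Defines a rational map P^(n-1) --> P^(m-1), provided that f <> 0. *)
Definition same_degree (m n : nat) (f : m.-tuple {mpoly K[n]}) : Prop :=
  exists e : nat, forall i, tnth f i \is e.-homog.

Definition curve_form (G : {mpoly K[3]}) : Prop :=
  irreducible_elt G /\ exists e : nat, G \is e.-homog.

Definition on_curve (G : {mpoly K[3]}) (x : 'rV[K]_3) : Prop :=
  x != 0 /\ vanishes_at G x.

(* psi : C --> P^1 and phi : P^1 --> C are mutually inverse rational maps, where
   C is the zero locus of G: each composite is defined and is the identity on a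
   dense open subset.  Since C and P^1 are irreducible, such a subset can be
   taken to be the nonempty complement of the zero locus of one form. *)
Definition birational_inverse (G : {mpoly K[3]})
    (psi : 2.-tuple {mpoly K[3]}) (phi : 3.-tuple {mpoly K[2]}) : Prop :=
  (exists (e : nat) (h : {mpoly K[3]}),
     [/\ h \is e.-homog,
         exists2 x, on_curve G x & ~ vanishes_at h x &
         forall x, on_curve G x -> ~ vanishes_at h x ->
           map_at psi x != 0 /\ proj_eq (map_at phi (map_at psi x)) x]) /\
  (exists (e : nat) (k : {mpoly K[2]}),
     [/\ k \is e.-homog,
         exists2 t : 'rV[K]_2, t != 0 & ~ vanishes_at k t &
         forall t : 'rV[K]_2, t != 0 -> ~ vanishes_at k t ->
           on_curve G (map_at phi t) /\
           proj_eq (map_at psi (map_at phi t)) t]).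

Definition rational_curve (G : {mpoly K[3]}) : Prop :=
  curve_form G /\
  exists (psi : 2.-tuple {mpoly K[3]}) (phi : 3.-tuple {mpoly K[2]}),
    [/\ same_degree psi, same_degree phi & birational_inverse G psi phi].

Definition parameterizable (G F1 F2 : {mpoly K[3]}) : Prop :=
  [/\ curve_form G,
      same_degree [tuple F1; F2],
      no_common_factor [:: F1; F2] &
      exists phi : 3.-tuple {mpoly K[2]},
        [/\ same_degree phi,
            no_common_factor phi,
            forall t : 'rV[K]_2, t != 0 -> on_curve G (map_at phi t) &
            birational_inverse G [tuple F1; F2] phi]].

Definition base_point (F1 F2 : {mpoly K[3]}) (x : 'rV[K]_3) : Prop :=
  [/\ x != 0, vanishes_at F1 x & vanishes_at F2 x].

Definition point001 : 'rV[K]_3 := delta_mx 0 2.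

(* a(F1, F2) X2 - b(F1, F2) X1 *)
Definition implicit_form (a b : {mpoly K[2]}) (F1 F2 : {mpoly K[3]}) :
    {mpoly K[3]} :=
  (a \mPo [tuple F1; F2]) * 'X_1 - (b \mPo [tuple F1; F2]) * 'X_0.

End PlaneCurves.

Arguments point001 {K}.

(* Main.v *)
(* Write F_i = X_3 l_i + q_i with l_i, q_i forms in X_1, X_2, let
   D = l_2 q_1 - l_1 q_2, a nonzero binary cubic, and P = a(F) X_2 - b(F) X_1.
   The line through (0 : 0 : 1) in the direction (a(T) : b(T)) meets the conic
   T_1 F_2 = T_2 F_1 in a second point phi(T); here F(phi(T)) is proportional to T,
   P vanishes along phi, and conversely D a(F)^2 X = X_1^2 phi(F(X)) modulo P.
   If P = U V W with U vanishing along phi, this identity and its analogue for b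
   show that V divides powers of a(F) and b(F) times powers of D, hence a power
   of D, because D = l_2 F_1 - l_1 F_2 lies in the ideal generated by any two
   independent members of the pencil.  So all factors of P but one are linear
   factors of D, i.e. lines through (0 : 0 : 1).  A Bezoutian argument on such a
   line bounds its multiplicity in P by its multiplicity in D, so the extraneous
   factor divides D and has degree at most 3. *)
From HB Require Import structures.
Require Import Defs.
From Stdlib Require Import Classical.
From mathcomp Require Import all_boot all_order all_algebra.
From mathcomp Require Import ring zify.
From mathcomp.multinomials Require Import mpoly.

Set Implicit Arguments.
Unset Strict Implicit.
Unset Printing Implicit Defensive.

Import GRing.Theory.
Local Open Scope ring_scope.

(** Nondegeneracy of the pencil conic means for l_1 and l_2 that they do not both vanish: otherwise
    T_1 F_2 - T_2 F_1 is a form in X_1, X_2 alone and splits. Together with the coprimality of F_1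
    and F_2 this makes D nonzero. Primality is established for linear forms, and that is enough: D
    splits over the closed field, so a cofactor divisible by no line of D can be freed from any
    power of D. The obstacle is to reach such a cofactor. A line may occur several times in D, and
    removing it from P as often as it occurs in D could leave further copies of it behind. The
    multiplicity bound excludes this. The condition d_0 > 2 matters because P has degree 2 d_0 + 1
    and multiplicity at least d_0 + 1 at (0 : 0 : 1), while at most three lines are removed: what
    remains is nonlinear and still passes through that point. *)

(** * Divisibility and prime elements in commutative rings *)

Lemma divides_refl (R : comUnitRingType) (d : R) : divides d d.
Proof. by exists 1; rewrite mulr1. Qed.

Lemma divides0 (R : comUnitRingType) (d : R) : divides d 0.
Proof. by exists 0; rewrite mulr0. Qed.

Lemma dividesD (R : comUnitRingType) (d p q : R) :
  divides d p -> divides d q -> divides d (p + q).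
Proof. by move=> [u ->] [v ->]; exists (u + v); rewrite mulrDr. Qed.

Lemma dividesMr (R : comUnitRingType) (d p q : R) :
  divides d p -> divides d (p * q).
Proof. by move=> [u ->]; exists (u * q); rewrite mulrA. Qed.

Lemma dividesMl (R : comUnitRingType) (d p q : R) :
  divides d p -> divides d (q * p).
Proof. by rewrite mulrC; apply: dividesMr. Qed.

Lemma divides_trans (R : comUnitRingType) (d p q : R) :
  divides d p -> divides p q -> divides d q.
Proof. by move=> [u ->] [v ->]; exists (u * v); rewrite mulrA. Qed.

Lemma divides_sum (R : comUnitRingType) (d : R) (I : Type) (r : seq I)
    (F : I -> R) :
  (forall i, divides d (F i)) -> divides d (\sum_(i <- r) F i).
Proof.
move=> dF; elim: r => [|i r IHr]; first by rewrite big_nil; apply: divides0.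
by rewrite big_cons; apply: dividesD.
Qed.

Lemma divides_eqmodM (R : comUnitRingType) (d p q u v : R) :
  divides d (p - q) -> divides d (u - v) -> divides d (p * u - q * v).
Proof.
move=> dpq duv; have ->: p * u - q * v = (p - q) * u + (u - v) * q by ring.
by apply: dividesD; apply: dividesMr.
Qed.

Lemma divides_eqmodX (R : comUnitRingType) (d p q : R) k :
  divides d (p - q) -> divides d (p ^+ k - q ^+ k).
Proof.
move=> dpq; elim: k => [|k IHk]; first by rewrite subrr; apply: divides0.
by rewrite !exprS; apply: divides_eqmodM.
Qed.

Lemma divides_eqmod_prod (R : comUnitRingType) (d : R) (I : Type) (r : seq I)
    (F G : I -> R) :
  (forall i, divides d (F i - G i)) ->
  divides d (\prod_(i <- r) F i - \prod_(i <- r) G i).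
Proof.
move=> dFG; elim: r => [|i r IHr].
  by rewrite !big_nil subrr; apply: divides0.
by rewrite !big_cons; apply: divides_eqmodM.
Qed.

Lemma divides_cancel (R : idomainType) (d p q : R) :
  d != 0 -> divides (d * p) (d * q) -> divides p q.
Proof. by move=> d0 [u]; rewrite -mulrA => /(mulfI d0) ->; exists u. Qed.

Lemma divides1_unit (R : comUnitRingType) (d : R) :
  divides d 1 -> d \is a GRing.unit.
Proof. by move=> [u du]; apply/unitrP; exists u; rewrite mulrC -du. Qed.

Definition prime_elt (R : comUnitRingType) (d : R) : Prop :=
  forall p q, divides d (p * q) -> divides d p \/ divides d q.

Lemma prime_elt_prod (R : comUnitRingType) (d : R) (s : seq R) :
  d \isn't a GRing.unit -> prime_elt d -> divides d (\prod_(p <- s) p) ->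
  exists2 p, p \in s & divides d p.
Proof.
move=> dU dP; elim: s => [|p s IHs].
  by rewrite big_nil => /divides1_unit; rewrite (negbTE dU).
rewrite big_cons => /dP[dp|/IHs[q qs dq]].
  by exists p; rewrite ?inE ?eqxx.
by exists q; rewrite // inE qs orbT.
Qed.

Lemma prime_power_divides (R : idomainType) (d p q : R) k :
  d != 0 -> prime_elt d -> ~ divides d p -> divides (d ^+ k) (p * q) ->
  divides (d ^+ k) q.
Proof.
move=> d0 dP dp; elim: k q => [|k IHk] q.
  by exists q; rewrite expr0 mul1r.
move=> [u]; rewrite exprS -mulrA => pq.
have [//|[q1 q1E]]: divides d p \/ divides d q by apply: dP; exists (d ^+ k * u).
have: divides (d ^+ k) (p * q1).
  by exists u; apply: (mulfI d0); rewrite -pq q1E mulrCA.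
by move=> /IHk[q2 q2E]; exists q2; rewrite q1E q2E mulrA.
Qed.

(** If the product times [M] is [V * u], a prime [d] that does not divide [V] divides [u] and
    cancels. The factorization of [V] itself may be unknown. *)
Lemma divides_coprime_prod (R : idomainType) (V M : R) (s : seq R) :
  (forall d, d \in s -> [/\ d != 0, prime_elt d & ~ divides d V]) ->
  divides V (\prod_(d <- s) d * M) -> divides V M.
Proof.
elim: s M => [|d s IHs] M hs; first by rewrite big_nil mul1r.
have [d0 dP dV]: [/\ d != 0, prime_elt d & ~ divides d V].
  by apply: hs; rewrite inE eqxx.
rewrite big_cons -mulrA => -[u uE].
have [//|[u1 u1E]]: divides d V \/ divides d u.
  by apply: dP; exists (\prod_(j <- s) j * M).
apply: IHs => [e es|]; first by apply: hs; rewrite inE es orbT.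
by exists u1; apply: (mulfI d0); rewrite uE u1E mulrCA.
Qed.

Lemma divides_coprime_prodX (R : idomainType) (V M : R) (s : seq R) k :
  (forall d, d \in s -> [/\ d != 0, prime_elt d & ~ divides d V]) ->
  divides V ((\prod_(d <- s) d) ^+ k * M) -> divides V M.
Proof.
move=> hs; elim: k => [|k IHk]; first by rewrite mul1r.
by rewrite exprS -mulrA => /(divides_coprime_prod hs).
Qed.

(** Modulo [b] each [f i] divides [c], so their product divides a power of [c]. *)
Lemma combination_prod (R : comUnitRingType) (I : eqType) (r : seq I) (f : I -> R)
    (b c : R) :
  (forall i, i \in r -> exists u v, c = u * f i + v * b) ->
  exists u v, c ^+ size r = u * \prod_(i <- r) f i + v * b.
Proof.
elim: r => [|i r IHr] hc; first by exists 1, 0; rewrite big_nil mul0r addr0 mul1r.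
have [u1 [v1 h1]] := hc i (mem_head i r).
have [j jr|u [v IH]] := IHr; first by apply: hc; rewrite inE jr orbT.
exists (u1 * u), (u1 * f i * v + v1 * c ^+ size r).
rewrite big_cons exprS {1}h1 mulrDl -mulrA IH; ring.
Qed.

Lemma combination_exp (R : comUnitRingType) (a b c : R) k :
  (exists u v, c = u * a + v * b) -> exists u v, c ^+ k = u * a ^+ k + v * b.
Proof.
move=> hc; have [|u [v]] := @combination_prod R unit (nseq k tt) (fun=> a) b c.
  by [].
by rewrite size_nseq big_nseq iter_mulr_1; exists u, v.
Qed.

(** * Substitution, homogeneity and linear forms in polynomial rings *)

Lemma comp_mpolyA (R : comRingType) n m k (p : {mpoly R[n]})
    (t : n.-tuple {mpoly R[m]}) (u : m.-tuple {mpoly R[k]}) :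
  (p \mPo t) \mPo u = p \mPo [tuple tnth t i \mPo u | i < n].
Proof.
rewrite [in RHS]comp_mpolyE [p \mPo t]comp_mpolyE raddf_sum /=; apply: eq_bigr => e _.
rewrite linearZ /= rmorph_prod /=; congr (_ *: _); apply: eq_bigr => i _.
by rewrite rmorphXn /= tnth_mktuple.
Qed.

Lemma comp_dhomogZ (R : comRingType) n m d (p : {mpoly R[n]}) (c : {mpoly R[m]})
    (t u : n.-tuple {mpoly R[m]}) :
  p \is d.-homog -> (forall i, tnth u i = c * tnth t i) ->
  p \mPo u = c ^+ d * (p \mPo t).
Proof.
move=> /dhomogP hp hu; rewrite !comp_mpolyE mulr_sumr.
rewrite big_seq [RHS]big_seq; apply: eq_bigr => e /hp <-.
rewrite -scalerAr; congr (_ *: _).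
under eq_bigr => i _ do rewrite hu exprMn.
by rewrite big_split /= prodrXr -mdegE.
Qed.

Lemma meval_dhomogZ (R : comRingType) n d (p : {mpoly R[n]}) (c : R)
    (x y : 'I_n -> R) :
  p \is d.-homog -> (forall i, y i = c * x i) ->
  p.@[y] = c ^+ d * p.@[x].
Proof.
move=> /dhomogP hp hu; rewrite !mevalE mulr_sumr.
rewrite big_seq [RHS]big_seq; apply: eq_bigr => e /hp <-.
rewrite mulrCA; congr (_ * _).
under eq_bigr => i _ do rewrite hu exprMn.
by rewrite big_split /= prodrXr -mdegE.
Qed.

Lemma comp_dhomog (R : comRingType) n m d e (p : {mpoly R[n]})
    (t : n.-tuple {mpoly R[m]}) :
  p \is d.-homog -> (forall i, tnth t i \is e.-homog) ->
  p \mPo t \is (e * d).-homog.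
Proof.
move=> /dhomogP hp ht; rewrite comp_mpolyE big_seq.
apply: rpred_sum => k /hp <-; apply: rpredZ.
rewrite /= mdegE big_distrr /=.
elim/big_ind2: _ => [|p1 e1 p2 e2 h1 h2|i _]; first exact: dhomog1.
  exact: dhomogM.
exact: dhomogMn.
Qed.

Lemma comp_mpoly_eqmod (R : idomainType) n m (d : {mpoly R[m]}) (p : {mpoly R[n]})
    (t u : n.-tuple {mpoly R[m]}) :
  (forall i, divides d (tnth t i - tnth u i)) ->
  divides d ((p \mPo t) - (p \mPo u)).
Proof.
move=> htu; rewrite !comp_mpolyE -sumrB; apply: divides_sum => e.
rewrite -scalerBr -mul_mpolyC; apply: dividesMl.
by apply: divides_eqmod_prod => i; apply: divides_eqmodX.
Qed.

(* The variables are scaled by a new one, which records the degree. *)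
Definition grade_poly (R : comRingType) n : {mpoly R[n]} -> {poly {mpoly R[n]}} :=
  mmap (@polyC _ \o @mpolyC n R) (fun i => 'X_i *: 'X).

HB.instance Definition _ (R : comRingType) n :=
  GRing.RMorphism.copy (@grade_poly R n) (@grade_poly R n).

Lemma grade_polyE (R : comRingType) n (p : {mpoly R[n]}) :
  grade_poly p = \sum_(m <- msupp p) (p@_m *: 'X_[m]) *: 'X^(mdeg m).
Proof.
rewrite /grade_poly /mmap; apply: eq_bigr => m _; rewrite /mmap1 /=.
under eq_bigr => i _ do rewrite exprZn.
rewrite scaler_prod prodrXr -mdegE -mpolyXE_id mul_polyC scalerA.
by rewrite mul_mpolyC.
Qed.

Lemma coef_grade_poly (R : comRingType) n (p : {mpoly R[n]}) d :
  (grade_poly p)`_d = pihomog mdeg d p.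
Proof.
rewrite grade_polyE coef_sum pihomogE [RHS]big_mkcond /=.
apply: eq_bigr => m _; rewrite coefZ coefXn eq_sym.
by case: eqP => _; rewrite ?mulr1 ?mulr0.
Qed.

Lemma dhomog_grade_poly (R : comRingType) n (p : {mpoly R[n]}) d :
  p \is d.-homog <-> grade_poly p = p *: 'X^d.
Proof.
split=> [hp|hp].
  apply/polyP => k; rewrite coef_grade_poly coefZ coefXn.
  have [->|kd] := eqVneq k d; first by rewrite mulr1 pihomog_dE.
  by rewrite mulr0 (pihomog_ne0 _ hp) 1?eq_sym.
rewrite (pihomog_partitionE (leqnn (mmeasure mdeg p))); apply: rpred_sum => k _.
rewrite -coef_grade_poly hp coefZ coefXn.
case: eqP => _; last by rewrite mulr0 rpred0.
have {1}<- : (grade_poly p)`_d = p by rewrite hp coefZ coefXn eqxx mulr1.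
by rewrite mulr1 coef_grade_poly pihomogP.
Qed.

(** Once the powers of ['X] are split off, both cofactors have a nonzero constant term. Hence
    [i + j = d], and the cofactors multiply to the constant [c], so over a domain they are
    constants. *)
Lemma mul_eq_monomial (R : idomainType) (p q : {poly R}) (c : R) d :
  c != 0 -> p * q = c *: 'X^d -> exists k a, p = a *: 'X^k.
Proof.
move=> c0 pq.
have pq0 : p * q != 0.
  by rewrite pq -mul_polyC mulf_neq0 ?polyC_eq0 // monic_neq0 // monicXn.
have [p0 q0] : p != 0 /\ q != 0 by move: pq0; rewrite mulf_eq0 negb_or => /andP[].
have [i [u]] := multiplicity_XsubC p 0; rewrite p0 subr0 /= => u0 pE.
have [j [v]] := multiplicity_XsubC q 0; rewrite q0 subr0 /= => v0 qE.
have uvE : u * v * 'X^(i + j) = c *: 'X^d.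
  by rewrite -pq pE qE exprD mulrACA.
have uv0 : (u * v)`_0 != 0.
  by rewrite -horner_coef0 hornerM mulf_neq0.
have ijd : (i + j)%N = d.
  have /eqP : (u * v * 'X^(i + j))`_(i + j) != 0 by rewrite coefMXn ltnn subnn.
  by rewrite uvE coefZ coefXn; case: eqP => // _; rewrite mulr0.
have uvc : u * v = c%:P.
  have X0 : 'X^(i + j) != 0 :> {poly R} by rewrite monic_neq0 // monicXn.
  by apply: (mulIf X0); rewrite uvE ijd mul_polyC.
have u1 : size u = 1%N.
  have un0 : u != 0 by move: u0; apply: contraNneq => ->; rewrite root0.
  have vn0 : v != 0 by move: v0; apply: contraNneq => ->; rewrite root0.
  move: (size_mul un0 vn0); rewrite uvc size_polyC c0.
  move: un0 vn0; rewrite -!size_poly_gt0.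
  by case: (size u) (size v) => [|[|a]] [|b] //=; rewrite addnS.
exists i, u`_0; rewrite pE -mul_polyC; congr (_ * _).
by apply: size1_polyC; rewrite u1.
Qed.

(** The grading polynomial of [p * q] is a monomial in the grading variable, so that of [p] is one
    too, and a single homogeneous component of [p] survives. *)
Lemma dhomog_factor (R : idomainType) n (p q : {mpoly R[n]}) d :
  p * q != 0 -> p * q \is d.-homog -> exists k, p \is k.-homog.
Proof.
move=> pq0 /dhomog_grade_poly; rewrite rmorphM /= => /(mul_eq_monomial pq0).
move=> [k [a pE]]; exists k.
rewrite (pihomog_partitionE (leqnn (mmeasure mdeg p))); apply: rpred_sum => j _.
have [<-|kj] := eqVneq (j : nat) k; first exact: pihomogP.
by rewrite -coef_grade_poly pE coefZ coefXn (negbTE kj) mulr0 rpred0.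
Qed.

Lemma dhomog_divides (R : idomainType) n (p q : {mpoly R[n]}) d :
  p != 0 -> p \is d.-homog -> divides q p -> exists k, q \is k.-homog.
Proof. by move=> p0 hp [u pE]; apply: (@dhomog_factor _ _ q u d); rewrite -pE. Qed.

Lemma msize_dhomog (R : idomainType) n (p : {mpoly R[n]}) d :
  p != 0 -> p \is d.-homog -> msize p = d.+1.
Proof.
move=> p0 hp; have := dhomog_uniq p0 hp (dhomog_msize hp).
by rewrite (mpolySpred _ p0) /= => ->.
Qed.

Lemma mpoly_unit_msize (F : fieldType) n (p : {mpoly F[n]}) :
  (p \is a GRing.unit) = (msize p == 1%N).
Proof.
apply/idP/msize_poly1P => [pU|[c c0 ->]]; last first.
  by apply: divides1_unit; exists (c^-1)%:MP; rewrite -mpolyCM mulfV.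
have pE : p = (p@_0)%:MP by apply/eqP; case/andP: pU.
exists p@_0 => //; apply: contraTneq pU => p00.
by rewrite pE p00 mpolyC0 unitr0.
Qed.

Lemma msize_divides (R : idomainType) n (p q : {mpoly R[n]}) :
  q != 0 -> divides p q -> (msize p <= msize q)%N.
Proof.
move=> q0 [u qE]; move: q0; rewrite qE mulf_eq0 negb_or => /andP[p0 u0].
by rewrite msizeM // (mpolySpred _ u0) addnS leq_addr.
Qed.

Lemma dhomogS_nunit (F : fieldType) n (p : {mpoly F[n]}) d :
  p \is d.+1.-homog -> p \isn't a GRing.unit.
Proof.
have [->|p0] := eqVneq p 0; first by rewrite unitr0.
by move=> /(msize_dhomog p0) pd; rewrite mpoly_unit_msize pd.
Qed.

Lemma dhomog0_const (R : ringType) n (p : {mpoly R[n]}) :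
  p \is 0.-homog -> exists c, p = c%:MP.
Proof.
move=> /dhomogP hp; exists p@_0; apply: msize1_polyC; rewrite msizeE big_seq.
by elim/big_ind: _ => // [x y|m /hp ->] //; rewrite geq_max => -> ->.
Qed.

(** Each monomial is charged to one variable occurring in it, so the [f i] are not unique. This is
    how linear and quadratic forms receive their coefficients. *)
Lemma dhomogS_sum (R : comRingType) n (p : {mpoly R[n]}) d :
  p \is d.+1.-homog ->
  exists2 f : 'I_n -> {mpoly R[n]},
    (forall i, f i \is d.-homog) & p = \sum_i 'X_i * f i.
Proof.
move=> /dhomogP hp; rewrite [p]mpolyE big_seq.
elim/big_ind: _ => [|x y [f hf ->] [g hg ->]|m mp].
- exists (fun=> 0) => [i|]; first exact: rpred0.
  by rewrite big1 // => i _; rewrite mulr0.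
- exists (fun i => f i + g i) => [i|]; first exact: rpredD.
  by rewrite -big_split; apply: eq_bigr => i _; rewrite mulrDr.
have md : mdeg m = d.+1 := hp _ mp.
have [i mi] : exists i, (0 < m i)%N.
  apply/existsP; apply: contra_eqT md => /existsPn m0.
  by rewrite mdegE big1 // => i _; apply/eqP; rewrite -leqn0 leqNgt m0.
have leUm : (U_(i) <= m)%MM by rewrite lep1mP -lt0n.
exists (fun j => if j == i then p@_m *: 'X_[m - U_(i)] else 0) => [j|].
  case: eqP => _; last exact: rpred0.
  apply: rpredZ; rewrite dhomogX /=; apply/eqP.
  have := mdegD U_(i) (m - U_(i)).
  by rewrite addmC submK // md mdeg1 => -[].
rewrite (bigD1 i) //= eqxx big1 ?addr0 => [|j /negbTE->]; last by rewrite mulr0.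
by rewrite -scalerAr -mpolyXD addmC submK.
Qed.

Lemma linear_formE (R : comRingType) n (l : {mpoly R[n]}) :
  l \is 1.-homog -> exists c : 'I_n -> R, l = \sum_i (c i)%:MP * 'X_i.
Proof.
move=> /dhomogS_sum[f hf ->].
have fC i : exists c, f i == c%:MP.
  by have [c ->] := dhomog0_const (hf i); exists c.
exists (fun i => (f i)@_0); apply: eq_bigr => i _.
by have [c /eqP->] := fC i; rewrite mulrC mcoeffC eqxx mulr1.
Qed.

(* Eliminating a variable with a nonzero coefficient in [l] identifies the
   quotient by [l] with a subring of the polynomial ring. *)
Lemma linear_form_elim (F : fieldType) n (l : {mpoly F[n]}) :
  l \is 1.-homog -> l != 0 ->
  exists t : n.-tuple {mpoly F[n]}, forall p, divides l p <-> p \mPo t = 0.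
Proof.
move=> hl l0; have [c lE] := linear_formE hl.
have [i ci] : exists i, c i != 0.
  apply/existsP; apply: contraNT l0 => /existsPn c0.
  rewrite lE big1 // => i _; have /negPn/eqP-> := c0 i.
  by rewrite mpolyC0 mul0r.
pose t := [tuple if j == i then 'X_i - (c i)^-1%:MP * l else 'X_j | j < n].
have lt0 : l \mPo t = 0.
  have XE j : 'X_j \mPo t = 'X_j - (if j == i then (c i)^-1%:MP * l else 0).
    rewrite comp_mpolyXU -tnth_nth tnth_mktuple.
    by case: eqP => [->|]; rewrite ?subr0.
  rewrite {1}lE raddf_sum /=.
  under eq_bigr => j _ do rewrite rmorphM /= comp_mpolyC XE mulrBr.
  rewrite big_split /= -lE sumrN (bigD1 i) //= eqxx big1 => [|j /negbTE->].
    by rewrite addr0 mulrA -mpolyCM mulfV // mul1r subrr.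
  by rewrite mulr0.
exists t => p; split=> [[u ->]|pt0]; first by rewrite rmorphM /= lt0 mul0r.
have: divides l ((p \mPo [tuple 'X_j | j < n]) - (p \mPo t)).
  apply: comp_mpoly_eqmod => j; rewrite !tnth_mktuple; case: eqP => [->|_].
    by rewrite subKr; apply/dividesMl/divides_refl.
  by rewrite subrr; apply: divides0.
by rewrite comp_mpoly_id pt0 subr0.
Qed.

Lemma linear_form_prime (F : fieldType) n (l : {mpoly F[n]}) :
  l \is 1.-homog -> l != 0 -> prime_elt l.
Proof.
move=> hl l0 p q; have [t ht] := linear_form_elim hl l0.
rewrite ht rmorphM /= => /eqP; rewrite mulf_eq0.
by case/orP=> /eqP; rewrite -ht; [left|right].
Qed.

(** * Forms in two variables *)

Definition pt2 (A : Type) (x y : A) (i : 'I_2) : A := if i == 0 then x else y.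

Lemma pt2_row (A : nzRingType) (v : 'rV[A]_2) : v 0 =1 pt2 (v 0 0) (v 0 1).
Proof.
by case=> [[|[|i]]] // hi; rewrite /pt2 -val_eqE /=; congr (v _ _); apply: val_inj.
Qed.

Lemma comp_mpoly_const (R : comRingType) n m (p : {mpoly R[n]}) (v : 'I_n -> R)
    (t : n.-tuple {mpoly R[m]}) :
  (forall i, tnth t i = (v i)%:MP) -> p \mPo t = (p.@[v])%:MP.
Proof.
move=> tv; rewrite comp_mpolyE mevalE rmorph_sum /=; apply: eq_bigr => e _.
rewrite mpolyCM mul_mpolyC rmorph_prod /=; congr (_ *: _).
by apply: eq_bigr => i _; rewrite rmorphXn /= tv.
Qed.

Lemma forall_ord2 (P : 'I_2 -> Prop) : P 0 -> P 1 -> forall i, P i.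
Proof.
by move=> P0 P1 [[|[|i]]] // hi; [move: P0|move: P1];
  congr P; apply: val_inj.
Qed.

Lemma forall_ord3 (P : 'I_3 -> Prop) : P 0 -> P 1 -> P 2 -> forall i, P i.
Proof.
by move=> P0 P1 P2 [[|[|[|i]]]] // hi; [move: P0|move: P1|move: P2];
  congr P; apply: val_inj.
Qed.

Lemma comp2_scale (R : comRingType) n d (p : {mpoly R[2]}) (c u v : {mpoly R[n]}) :
  p \is d.-homog ->
  p \mPo [tuple c * u; c * v] = c ^+ d * (p \mPo [tuple u; v]).
Proof. by move=> hp; apply: comp_dhomogZ hp _; apply: forall_ord2. Qed.

Lemma comp2_const (R : comRingType) n (p : {mpoly R[2]}) (x y : R) :
  p \mPo [tuple x%:MP_[n]; y%:MP] = (p.@[pt2 x y])%:MP.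
Proof. by apply: comp_mpoly_const; apply: forall_ord2. Qed.

Lemma comp2_eqmod (R : idomainType) n (d : {mpoly R[n]}) (p : {mpoly R[2]})
    (u v u' v' : {mpoly R[n]}) :
  divides d (u - u') -> divides d (v - v') ->
  divides d (p \mPo [tuple u; v] - (p \mPo [tuple u'; v'])).
Proof. by move=> hu hv; apply: comp_mpoly_eqmod; apply: forall_ord2. Qed.

Lemma comp2_id (R : comRingType) (p : {mpoly R[2]}) :
  p \mPo [tuple 'X_0; 'X_1] = p.
Proof.
rewrite -[RHS]comp_mpoly_id; congr (p \mPo _).
by apply: eq_from_tnth; apply: forall_ord2; rewrite tnth_mktuple.
Qed.

Lemma comp2A (R : comRingType) n m (p : {mpoly R[2]}) (u v : {mpoly R[n]})
    (t : n.-tuple {mpoly R[m]}) :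
  (p \mPo [tuple u; v]) \mPo t = p \mPo [tuple u \mPo t; v \mPo t].
Proof.
rewrite comp_mpolyA; congr (p \mPo _).
by apply: eq_from_tnth; apply: forall_ord2; rewrite tnth_mktuple.
Qed.

Lemma comp2_meval (R : comRingType) n (p : {mpoly R[2]}) (u v : {mpoly R[n]})
    (x : 'I_n -> R) :
  (p \mPo [tuple u; v]).@[x] = p.@[pt2 u.@[x] v.@[x]].
Proof.
by rewrite comp_mpoly_meval; apply: meval_eq; apply: forall_ord2.
Qed.

Lemma pt2_eq0 (A : nzRingType) (x y : A) (P : Prop) :
  (x != 0 -> P) -> (y != 0 -> P) -> (x, y) != (0, 0) -> P.
Proof. by move=> hx hy; rewrite xpair_eqE negb_and => /orP[]. Qed.

Definition line_through (R : comRingType) (x y : R) : {mpoly R[2]} :=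
  y%:MP * 'X_0 - x%:MP * 'X_1.

Lemma line_through_homog (R : comRingType) (x y : R) :
  line_through x y \is 1.-homog.
Proof.
by apply: rpredB; rewrite mul_mpolyC; apply: rpredZ; rewrite dhomogX /= mdeg1.
Qed.

Lemma line_through_neq0 (R : comRingType) (x y : R) :
  (x, y) != (0, 0) -> line_through x y != 0.
Proof.
have E u v : (line_through x y).@[pt2 u v] = y * u - x * v.
  by rewrite rmorphB !rmorphM /= !mevalC !mevalXU.
apply: pt2_eq0; apply: contraNneq => l0.
  by have /eqP := E 0 1; rewrite l0 meval0 mulr0 mulr1 sub0r eq_sym oppr_eq0.
by have /eqP := E 1 0; rewrite l0 meval0 mulr0 mulr1 subr0 eq_sym.
Qed.

(** Modulo [l = line_through x y] the vectors [x * ('X_0, 'X_1)] and ['X_0 * (x, y)] agree, and [p]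
    vanishes at the second, so [l] divides [x ^+ d.+1 * p]. The coordinate [y] serves in the same
    way when it is the nonzero one. *)
Lemma binary_form_factor (F : fieldType) (p : {mpoly F[2]}) d (x y : F) :
  p \is d.+1.-homog -> (x, y) != (0, 0) -> p.@[pt2 x y] = 0 ->
  exists2 q, q \is d.-homog & p = line_through x y * q.
Proof.
move=> hp xy pxy.
have [p0|p0] := eqVneq p 0.
  by exists 0; [apply: rpred0|rewrite mulr0].
set l := line_through x y.
have proportional (c : {mpoly F[2]}) : p \mPo [tuple c * x%:MP; c * y%:MP] = 0.
  by rewrite (comp2_scale _ _ _ hp) comp2_const pxy mpolyC0 mulr0.
have scale (c : F) : p \mPo [tuple c%:MP * 'X_0; c%:MP * 'X_1] = (c ^+ d.+1)%:MP * p.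
  by rewrite (comp2_scale _ _ _ hp) comp2_id rmorphXn.
have lp : divides l p.
  have cancel c : c != 0 -> divides l ((c ^+ d.+1)%:MP * p) -> divides l p.
    move=> c0 [u cu]; exists ((c ^- d.+1)%:MP * u).
    rewrite mulrCA -cu mulrA -mpolyCM mulVf ?mpolyC1 ?mul1r //.
    by rewrite expf_neq0.
  apply: pt2_eq0 xy => [x0|y0].
    apply: (cancel x) => //; rewrite -scale.
    rewrite -[X in divides _ X]subr0 -(proportional 'X_0).
    apply: comp2_eqmod; first by rewrite mulrC subrr; apply: divides0.
    by exists (-1); rewrite /l /line_through; ring.
  apply: (cancel y) => //; rewrite -scale.
  rewrite -[X in divides _ X]subr0 -(proportional 'X_1).
  apply: comp2_eqmod; last by rewrite mulrC subrr; apply: divides0.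
  by exists 1; rewrite /l /line_through; ring.
have [q pE] := lp; exists q => //.
have [k hq] : exists k, q \is k.-homog.
  by apply: (@dhomog_factor _ _ q l d.+1); rewrite mulrC -pE.
have := dhomogM (line_through_homog x y) hq; rewrite -/l -pE => hp'.
by have [->] := dhomog_uniq p0 hp hp'.
Qed.

Definition dehomogenize (R : comRingType) : {mpoly R[2]} -> {poly R} :=
  mmap (@polyC R) (pt2 'X 1).

Lemma dehomogenizeE (R : comRingType) (p : {mpoly R[2]}) :
  dehomogenize p = \sum_(m <- msupp p) p@_m *: 'X^(m 0).
Proof.
rewrite /dehomogenize /mmap; apply: eq_bigr => m _.
by rewrite /mmap1 big_ord_recl big_ord1 /pt2 /= expr1n mulr1 mul_polyC.
Qed.

Lemma horner_dehomogenize (R : comRingType) (p : {mpoly R[2]}) x :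
  (dehomogenize p).[x] = p.@[pt2 x 1].
Proof.
rewrite dehomogenizeE mevalE horner_sum; apply: eq_bigr => m _.
by rewrite hornerZ hornerXn big_ord_recl big_ord1 /pt2 /= expr1n mulr1.
Qed.

Lemma coef_dehomogenize (R : comRingType) (p : {mpoly R[2]}) d :
  p \is d.-homog -> (dehomogenize p)`_d = p.@[pt2 1 0].
Proof.
move=> /dhomogP hp; rewrite dehomogenizeE mevalE coef_sum.
rewrite big_seq [RHS]big_seq; apply: eq_bigr => m /hp /= md.
rewrite coefZ coefXn big_ord_recl big_ord1 /pt2 /= expr1n mul1r expr0n.
have -> : lift ord0 ord0 = 1 :> 'I_2 by apply: val_inj.
congr (_ * _%:R); move: md; rewrite mdegE big_ord_recl big_ord1 => <-.
have -> : lift ord0 ord0 = 1 :> 'I_2 by apply: val_inj.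
by rewrite -[X in _ == X]addn0 eqn_add2l.
Qed.

Lemma dehomogenize_eq0 (R : comRingType) (p : {mpoly R[2]}) d :
  p \is d.-homog -> dehomogenize p = 0 -> p = 0.
Proof.
move=> /dhomogP hp r0; apply/mpolyP => m; rewrite mcoeff0.
have [mp|/memN_msupp_eq0//] := boolP (m \in msupp p).
have := congr1 (fun r : {poly R} => r`_(m 0)) r0.
rewrite dehomogenizeE coef_sum coef0 (bigD1_seq m) //= big_seq_cond big1.
  by rewrite coefZ coefXn eqxx mulr1 addr0.
move=> e /andP[ep em]; rewrite coefZ coefXn; case: eqP => [me|_]; last first.
  by rewrite mulr0.
case/eqP: em; apply/mnmP; apply: forall_ord2 => //.
have : mdeg e = mdeg m :> nat by rewrite [LHS](hp e ep) [RHS](hp m mp).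
rewrite !mdegE !big_ord_recl !big_ord0 /= !addn0.
have -> : lift ord0 ord0 = 1 :> 'I_2 by apply: val_inj.
by rewrite -[ord0]/(0 : 'I_2) me => /addnI.
Qed.

Lemma binary_form_nonroot (F : closedFieldType) (p : {mpoly F[2]}) d :
  p \is d.-homog -> p != 0 -> exists x, p.@[pt2 x 1] != 0.
Proof.
move=> hp p0; have /closed_nonrootP[x] : dehomogenize p != 0.
  by apply: contraNneq p0 => /(dehomogenize_eq0 hp) ->.
by rewrite rootE horner_dehomogenize; exists x.
Qed.

Lemma binary_form_root (F : closedFieldType) (p : {mpoly F[2]}) d :
  p \is d.+1.-homog -> exists x y, (x, y) != (0, 0) /\ p.@[pt2 x y] = 0.
Proof.
(* A nonzero constant has no root in the affine chart, but then the coefficient of degree [d.+1],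
   which is the value at (1 : 0), is zero. *)
move=> hp; have [r1|r1] := eqVneq (size (dehomogenize p)) 1%N.
  exists 1, 0; rewrite xpair_eqE oner_eq0; split=> //.
  by rewrite -(coef_dehomogenize hp) nth_default ?r1.
have [x] := closed_rootP _ r1; rewrite rootE horner_dehomogenize => /eqP px.
by exists x, 1; rewrite xpair_eqE oner_eq0 andbF.
Qed.

Lemma binary_form_split (F : closedFieldType) (p : {mpoly F[2]}) d :
  p \is d.-homog -> p != 0 ->
  exists c ls, [/\ c != 0, size ls = d, p = c%:MP * \prod_(l <- ls) l &
                   forall l, l \in ls -> l \is 1.-homog /\ l != 0].
Proof.
elim: d p => [|d IHd] p hp p0.
  have [c pE] := dhomog0_const hp; exists c, [::]; rewrite big_nil mulr1.
  by split=> //; apply: contraNneq p0 => c0; rewrite pE c0.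
have [x [y [xy pxy]]] := binary_form_root hp.
have [q hq pE] := binary_form_factor hp xy pxy.
have q0 : q != 0 by apply: contraNneq p0 => q0; rewrite pE q0 mulr0.
have [c [ls [c0 lsd qE hls]]] := IHd q hq q0.
exists c, (line_through x y :: ls); split=> //=; first by rewrite lsd.
  by rewrite pE qE big_cons mulrCA.
move=> l; rewrite inE => /orP[/eqP->|/hls//].
by split; [apply: line_through_homog|apply: line_through_neq0].
Qed.

Definition no_common_zero (R : comRingType) n (f : n.-tuple {mpoly R[2]}) : Prop :=
  forall x y, (x, y) != (0, 0) -> exists i, (tnth f i).@[pt2 x y] != 0.

Lemma no_common_zero_factor (F : closedFieldType) n (f : n.-tuple {mpoly F[2]}) e :
  (forall i, tnth f i \is e.-homog) -> no_common_zero f -> no_common_factor f.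
Proof.
move=> hf nz d df.
have {}df i : divides d (tnth f i) by apply: df; apply: mem_tnth.
have [|i fi] := nz 1 0; first by rewrite xpair_eqE oner_eq0.
have fi0 : tnth f i != 0 by apply: contraNneq fi => ->; rewrite meval0.
have d0 : d != 0.
  by apply: contraNneq fi0 => d0; have [u ->] := df i; rewrite d0 mul0r.
have [[|k] hd] := dhomog_divides fi0 (hf i) (df i).
  by rewrite mpoly_unit_msize (msize_dhomog d0 hd).
have [x [y [xy dxy]]] := binary_form_root hd.
have [j] := nz x y xy; have [u ->] := df j.
by rewrite rmorphM /= dxy mul0r eqxx.
Qed.

Lemma no_common_factor_zero (F : closedFieldType) (a b : {mpoly F[2]}) d :
  a \is d.+1.-homog -> b \is d.+1.-homog -> no_common_factor [:: a; b] ->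
  forall x y, (x, y) != (0, 0) -> a.@[pt2 x y] = 0 -> b.@[pt2 x y] <> 0.
Proof.
move=> ha hb ab x y xy axy bxy.
have := dhomogS_nunit (line_through_homog x y); rewrite ab // => p.
have [q _ aE] := binary_form_factor ha xy axy.
have [r _ bE] := binary_form_factor hb xy bxy.
by rewrite !inE => /orP[] /eqP->; [exists q|exists r].
Qed.

(** Common zeros are removed one linear factor at a time, so the degree drops; in degree 0 a nonzero
    constant entry ends the process. This will turn [phi] into a map defined on the whole projective
    line. *)
Lemma remove_common_zeros (F : closedFieldType) n (f : n.-tuple {mpoly F[2]}) e :
  (forall i, tnth f i \is e.-homog) -> (exists i, tnth f i != 0) ->
  exists (g : {mpoly F[2]}) k (f0 : n.-tuple {mpoly F[2]}),
    [/\ forall i, tnth f0 i \is k.-homog, no_common_zero f0 &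
        forall i, tnth f i = g * tnth f0 i].
Proof.
elim: e f => [|e IHe] f hf [i fi].
  exists 1, 0%N, f; split=> // [x y _|j]; last by rewrite mul1r.
  exists i; have [c fE] := dhomog0_const (hf i); rewrite fE mevalC.
  by move: fi; rewrite fE; apply: contraNneq => ->.
have [nz|] := classic (no_common_zero f).
  by exists 1, e.+1, f; split=> // j; rewrite mul1r.
move=> nz; have [x {}nz] := not_all_ex_not _ _ nz.
have [y {}nz] := not_all_ex_not _ _ nz.
have [xy fxy] := imply_to_and _ _ nz.
have fxy0 j : (tnth f j).@[pt2 x y] = 0.
  by apply/eqP/negPn/negP => fj; apply: fxy; exists j.
(* The body is boolean so that [xchoose] selects the cofactors for all [j] at once. *)
have factor j : exists q, (q \is e.-homog) && (tnth f j == line_through x y * q).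
  have [q hq fE] := binary_form_factor (hf j) xy (fxy0 j).
  by exists q; rewrite hq fE eqxx.
pose f' := [tuple xchoose (factor j) | j < n].
have f'P j : tnth f' j \is e.-homog /\ tnth f j = line_through x y * tnth f' j.
  by rewrite tnth_mktuple; have /andP[? /eqP] := xchooseP (factor j).
have [||g [k [f0 [hf0 nz0 f0E]]]] := IHe f'; first by move=> j; have [] := f'P j.
  exists i; move: fi; have [_ ->] := f'P i.
  by apply: contraNneq => ->; rewrite mulr0.
exists (line_through x y * g), k, f0; split=> // j.
by have [_ ->] := f'P j; rewrite f0E mulrA.
Qed.

(** The degree is written [d.+1] to be positive, so that each form does have a zero. *)
Definition coprime_forms (F : closedFieldType) d (a b : {mpoly F[2]}) : Prop :=
  [/\ a \is d.+1.-homog, b \is d.+1.-homog &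
      forall x y, (x, y) != (0, 0) -> a.@[pt2 x y] = 0 -> b.@[pt2 x y] <> 0].

(** A relation with [x != 0] would make a zero of [b] a zero of [a], and symmetrically. *)
Lemma coprime_forms_independent (F : closedFieldType) d (a b : {mpoly F[2]}) x y :
  coprime_forms d a b -> (x, y) != (0, 0) -> x%:MP * a + y%:MP * b != 0.
Proof.
move=> [ha hb ab] xy; apply/eqP => ab0.
have rel u v : x * a.@[pt2 u v] + y * b.@[pt2 u v] = 0.
  have := congr1 (meval (pt2 u v)) ab0.
  by rewrite meval0 rmorphD !rmorphM /= !mevalC.
apply: pt2_eq0 xy => [x0|y0].
  have [u [v [uv buv]]] := binary_form_root hb.
  apply: (ab u v) => //; have /eqP := rel u v.
  by rewrite buv mulr0 addr0 mulf_eq0 (negbTE x0) => /eqP.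
have [u [v [uv auv]]] := binary_form_root ha.
apply: (ab u v) => //; have /eqP := rel u v.
by rewrite auv mulr0 add0r mulf_eq0 (negbTE y0) => /eqP.
Qed.

Lemma binary_linear_formE (R : comRingType) (l : {mpoly R[2]}) :
  l \is 1.-homog -> exists x y, l = x%:MP * 'X_0 + y%:MP * 'X_1.
Proof.
move=> /linear_formE[c ->]; exists (c 0), (c 1).
rewrite big_ord_recl big_ord1; congr (_ * 'X__ + _%:MP * 'X__).
- by congr c; apply: val_inj.
by apply: val_inj.
Qed.

(** Over a closed field [p] splits, and each linear factor becomes a nontrivial combination of [a]
    and [b]. *)
Lemma coprime_forms_comp_neq0 (F : closedFieldType) d e (a b p : {mpoly F[2]}) :
  coprime_forms d a b -> p \is e.-homog -> p != 0 -> p \mPo [tuple a; b] != 0.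
Proof.
move=> hab hp p0; have [c [ls [c0 _ -> hls]]] := binary_form_split hp p0.
rewrite rmorphM rmorph_prod /= comp_mpolyC mulf_neq0 ?mpolyC_eq0 //.
rewrite prodf_seq_neq0; apply/allP => l /hls[/binary_linear_formE[x [y lE]] l0].
rewrite /= lE rmorphD !rmorphM /= !comp_mpolyC !comp_mpolyXU /=.
apply: (coprime_forms_independent hab).
apply: contraNneq l0 => -[x0 y0].
by rewrite lE x0 y0 mpolyC0 !mul0r addr0.
Qed.

(** * Bezoutians, and pencils of conics through (0 : 0 : 1) *)

Lemma bezoutian_divides (R : idomainType) n d (a b : {mpoly R[2]})
    (u v u' v' : {mpoly R[n]}) :
  a \is d.-homog -> b \is d.-homog ->
  divides (u * v' - v * u')
    ((a \mPo [tuple u; v]) * (b \mPo [tuple u'; v'])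
     - (a \mPo [tuple u'; v']) * (b \mPo [tuple u; v])).
Proof.
(* Bilinearity in [a] and [b] reduces the claim to two monomials. With [k = i - j], the common
   factor [(u * u') ^+ j * (v * v') ^+ p] leaves [(u * v') ^+ k - (v * u') ^+ k]. *)
move=> /dhomogP ha /dhomogP hb.
have monomial i j p q : (i + p = j + q)%N ->
    divides (u * v' - v * u')
      (u ^+ i * v ^+ p * (u' ^+ j * v' ^+ q)
       - u' ^+ i * v' ^+ p * (u ^+ j * v ^+ q)).
  wlog ij : i j p q / (j <= i)%N => [hw|] ipjq.
    have [/hw/(_ ipjq)//|/ltnW ij] := leqP j i.
    have [w wE] := hw j i q p ij (esym ipjq); exists (- w).
    by rewrite mulrN -wE; ring.
  rewrite -(subnKC ij) in ipjq *; move: (i - j)%N ipjq => k ipjq.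
  have -> : q = (p + k)%N by apply/eqP; rewrite -(eqn_add2l j) -ipjq addnAC addnA.
  have [w wE] : divides (u * v' - v * u') ((u * v') ^+ k - (v * u') ^+ k).
    exact/divides_eqmodX/divides_refl.
  exists (w * ((u * u') ^+ j * (v * v') ^+ p)); rewrite [RHS]mulrA -wE.
  rewrite !exprD !exprMn; ring.
have expand (p : {mpoly R[2]}) x y : p \mPo [tuple x; y] =
    \sum_(m <- msupp p) p@_m *: (x ^+ m 0 * y ^+ m 1) :> {mpoly R[n]}.
  rewrite comp_mpolyE; apply: eq_bigr => m _; rewrite big_ord_recl big_ord1.
  by have -> : lift ord0 ord0 = 1 :> 'I_2 by apply: val_inj.
rewrite !expand !big_distrlr /= -sumrB.
rewrite big_seq; elim/big_ind: _ => [|p q hp hq|m ma]; first exact: divides0.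
  exact: dividesD.
rewrite -sumrB big_seq; elim/big_ind: _ => [|p q hp hq|m' mb].
- exact: divides0.
- exact: dividesD.
rewrite -!scalerAl -!scalerAr !scalerA -scalerBr -mul_mpolyC; apply: dividesMl.
apply: monomial.
have : mdeg m = mdeg m' :> nat by rewrite [LHS](ha m ma) [RHS](hb m' mb).
rewrite !mdegE !big_ord_recl !big_ord0 !addn0.
by have -> : lift ord0 ord0 = 1 :> 'I_2 by apply: val_inj.
Qed.

(** The quotient is computed once, in four generic variables. Having one [B] for all substitutions
    allows its values at two of them to be compared. *)
Lemma bezoutian (R : idomainType) d (a b : {mpoly R[2]}) :
  a \is d.-homog -> b \is d.-homog ->
  exists B : {mpoly R[4]}, forall n (u v u' v' : {mpoly R[n]}),
    (a \mPo [tuple u; v]) * (b \mPo [tuple u'; v'])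
      - (a \mPo [tuple u'; v']) * (b \mPo [tuple u; v])
    = (u * v' - v * u') * (B \mPo [tuple u; v; u'; v']).
Proof.
move=> ha hb.
have [B BE] := bezoutian_divides 'X_0 'X_1 ('X_2 : {mpoly R[4]}) 'X_3 ha hb.
exists B => n u v u' v'.
have := congr1 (comp_mpoly [tuple u; v; u'; v']) BE.
by rewrite rmorphM !rmorphB !rmorphM /= !comp2A !comp_mpolyXU.
Qed.

(* A quadratic form through (0 : 0 : 1) is [u * lpart + qpart] in the
   coordinates [s, t, u]; [c] lists its five coefficients. *)
Definition lpart (A : comNzRingType) (c : nat -> A) (s t : A) : A :=
  c 0%N * s + c 1%N * t.

Definition qpart (A : comNzRingType) (c : nat -> A) (s t : A) : A :=
  c 2 * s ^+ 2 + c 3 * (s * t) + c 4 * t ^+ 2.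

Definition conic (A : comNzRingType) (c : nat -> A) (s t u : A) : A :=
  u * lpart c s t + qpart c s t.

(* It vanishes on the lines joining (0 : 0 : 1) to the base points of the pencil
   (and on the base tangents there). *)
Definition cubic (A : comNzRingType) (c1 c2 : nat -> A) (s t : A) : A :=
  lpart c2 s t * qpart c1 s t - lpart c1 s t * qpart c2 s t.

(** Coefficients are kept as a sequence so that [conic], [cubic] and the like apply both to scalars
    and, through [mpC], to polynomials. *)
Definition mpC (R : nzRingType) n (c : nat -> R) (i : nat) : {mpoly R[n]} :=
  (c i)%:MP.

Lemma comp_conic (R : comNzRingType) n m (c : nat -> R) (s t u : {mpoly R[n]})
    (h : n.-tuple {mpoly R[m]}) :
  conic (mpC n c) s t u \mPo h = conic (mpC m c) (s \mPo h) (t \mPo h) (u \mPo h).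
Proof. by rewrite !(rmorphD, rmorphM, rmorphXn) /= !comp_mpolyC. Qed.

Lemma comp_cubic (R : comNzRingType) n m (c1 c2 : nat -> R) (s t : {mpoly R[n]})
    (h : n.-tuple {mpoly R[m]}) :
  cubic (mpC n c1) (mpC n c2) s t \mPo h
  = cubic (mpC m c1) (mpC m c2) (s \mPo h) (t \mPo h).
Proof. by rewrite !(rmorphB, rmorphD, rmorphM, rmorphXn) /= !comp_mpolyC. Qed.

Lemma meval_conic (R : comNzRingType) n (c : nat -> R) (s t u : {mpoly R[n]})
    (x : 'I_n -> R) :
  (conic (mpC n c) s t u).@[x] = conic c s.@[x] t.@[x] u.@[x].
Proof. by rewrite !(rmorphD, rmorphM, rmorphXn) /= !mevalC. Qed.

Lemma meval_cubic (R : comNzRingType) n (c1 c2 : nat -> R) (s t : {mpoly R[n]})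
    (x : 'I_n -> R) :
  (cubic (mpC n c1) (mpC n c2) s t).@[x] = cubic c1 c2 s.@[x] t.@[x].
Proof. by rewrite !(rmorphB, rmorphD, rmorphM, rmorphXn) /= !mevalC. Qed.

Lemma mpoly1_divX (F : fieldType) (p : {mpoly F[1]}) :
  divides 'X_0 p <-> p.@[fun=> 0] = 0.
Proof.
split=> [[u ->]|p0]; first by rewrite rmorphM /= mevalXU mul0r.
have : divides 'X_0 ((p \mPo [tuple 'X_i | i < 1]) - (p \mPo [tuple 0])).
  apply: comp_mpoly_eqmod => i; rewrite tnth_mktuple !ord1 (tnth_nth 0) /= subr0.
  exact: divides_refl.
rewrite comp_mpoly_id (@comp_mpoly_const _ _ _ _ (fun=> 0)) ?p0 ?mpolyC0 ?subr0 //.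
by move=> i; rewrite ord1 (tnth_nth 0); apply/esym/mpolyC0.
Qed.

Lemma mpolyX_linear (R : nzRingType) n (i : 'I_n) : ('X_i : {mpoly R[n]}) \is 1.-homog.
Proof. by rewrite dhomogX /= mdeg1. Qed.

Lemma mpolyX_neq0 (R : nzRingType) n (i : 'I_n) : 'X_i != 0 :> {mpoly R[n]}.
Proof. by rewrite -msize_poly_eq0 msizeX mdeg1. Qed.

Lemma affine_nonroots (F : closedFieldType) (l q : F) :
  (l, q) != (0, 0) ->
  exists z z', [/\ z != z', z * l + q != 0 & z' * l + q != 0].
Proof.
move=> lq; pose r := l *: 'X + q%:P.
have rE z : r.[z] = z * l + q.
  by rewrite hornerD hornerZ hornerX hornerC mulrC.
have r0 : r != 0.
  apply: pt2_eq0 lq; apply: contraNneq => r0.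
    have := congr1 (fun p : {poly F} => p`_1) r0.
    by rewrite /r coefD coefZ coefX coefC coef0 /= mulr1 addr0 => ->.
  have := congr1 (fun p : {poly F} => p`_0) r0.
  by rewrite /r coefD coefZ coefX coefC coef0 /= mulr0 add0r => ->.
have [z rz] := closed_nonrootP _ r0.
have r1 : r * ('X - z%:P) != 0 by rewrite mulf_neq0 // polyXsubC_eq0.
have [z' ] := closed_nonrootP _ r1; rewrite rootM negb_or => /andP[rz' zz'].
exists z, z'; rewrite -!rE; split=> //.
by rewrite eq_sym; move: zz'; rewrite root_XsubC.
Qed.

(** Cramer's rule modulo [x]: the determinant of two linear relations on [(y1, y2)] annihilates both
    [y1] and [y2]. *)
Lemma cross_elimination (R : comNzRingType) (x y1 y2 a b a' b' p p' : R) :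
  a * y2 - b * y1 = x * p -> a' * y2 - b' * y1 = x * p' ->
  y1 * (a' * b - a * b') = x * (a * p' - a' * p) /\
  y2 * (a' * b - a * b') = x * (b * p' - b' * p).
Proof.
move=> E E'.
have R1 u v w : x * (u * p' - v * p) + w = u * (x * p') - v * (x * p) + w by ring.
split; rewrite -[RHS]addr0 R1 -E -E'; ring.
Qed.

(* On the line through (0 : 0 : 1) in the direction [v], the points of the
   pencil have a single image, and [a/b] cannot be ramified there if the
   multiplicity [e] exceeds 1; so the Bezoutian of [a] and [b] is a unit at
   [x = 0], and its product with [cubic] is divisible by [x ^+ e]. *)
Lemma line_multiplicity_le_cubic (F : closedFieldType) d (a b : {mpoly F[2]})
    (c1 c2 : nat -> F) (v1 v2 w1 w2 : F) e :
  let x : {mpoly F[1]} := 'X_0 in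
  let y1 := v1%:MP + w1%:MP * x in
  let y2 := v2%:MP + w2%:MP * x in
  let f c z := conic (mpC 1 c) y1 y2 z%:MP in
  coprime_forms d a b -> v1 * w2 - v2 * w1 != 0 ->
  cubic c1 c2 v1 v2 = 0 ->
  (lpart c1 v1 v2, qpart c1 v1 v2) != (0, 0) \/
  (lpart c2 v1 v2, qpart c2 v1 v2) != (0, 0) ->
  (forall z : F, divides (x ^+ e)
     ((a \mPo [tuple f c1 z; f c2 z]) * y2 - (b \mPo [tuple f c1 z; f c2 z]) * y1)) ->
  divides (x ^+ e) (cubic (mpC 1 c1) (mpC 1 c2) y1 y2).
Proof.
move=> x y1 y2 f [ha hb ab] vw D0 base hP.
have ev_y1 : y1.@[fun=> 0] = v1.
  by rewrite rmorphD rmorphM /= !mevalC mevalXU mulr0 addr0.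
have ev_y2 : y2.@[fun=> 0] = v2.
  by rewrite rmorphD rmorphM /= !mevalC mevalXU mulr0 addr0.
have xD : divides x (cubic (mpC 1 c1) (mpC 1 c2) y1 y2).
  by apply/mpoly1_divX; rewrite meval_cubic ev_y1 ev_y2.
have x0 : x != 0 by apply: mpolyX_neq0.
have xP : prime_elt x by apply: linear_form_prime => //; apply: mpolyX_linear.
(* Exponent 0 is trivial and exponent 1 is the vanishing of the cubic at [x = 0]. From here on [e]
   is the exponent minus 2. *)
case: e hP => [|[|e]] hP; first by rewrite expr0; exists (cubic (mpC 1 c1) (mpC 1 c2) y1 y2); rewrite mul1r.
  by rewrite expr1.
pose t c z := conic c v1 v2 z.
have ev_f c z : (f c z).@[fun=> 0] = t c z by rewrite meval_conic ev_y1 ev_y2 mevalC.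
(* Two points of the line that are not base points: each conic restricts to an affine function of
   [z], and by [base] one of the two is not identically zero. *)
have [z [z' [zz' tz tz']]] : exists z z', [/\ z != z',
    (t c1 z, t c2 z) != (0, 0) & (t c1 z', t c2 z') != (0, 0)].
  by case: base => /affine_nonroots[z [z' [zz' tz tz']]]; exists z, z';
    rewrite !xpair_eqE !negb_and tz tz' ?orbT.
pose A z := a.@[pt2 (t c1 z) (t c2 z)]; pose B z := b.@[pt2 (t c1 z) (t c2 z)].
have ev_a z0 : (a \mPo [tuple f c1 z0; f c2 z0]).@[fun=> 0] = A z0.
  by rewrite comp2_meval !ev_f.
have ev_b z0 : (b \mPo [tuple f c1 z0; f c2 z0]).@[fun=> 0] = B z0.
  by rewrite comp2_meval !ev_f.
have AB z0 : A z0 * v2 = B z0 * v1.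
  have /mpoly1_divX : divides x
      ((a \mPo [tuple f c1 z0; f c2 z0]) * y2 - (b \mPo [tuple f c1 z0; f c2 z0]) * y1).
    by have [u ->] := hP z0; rewrite exprS -mulrA; exists (x ^+ e.+1 * u).
  by rewrite rmorphB !rmorphM /= ev_a ev_b ev_y1 ev_y2 => /eqP; rewrite subr_eq0 => /eqP.
have [Bz BzE] := bezoutian ha hb.
pose Bgf := Bz \mPo [tuple f c1 z'; f c2 z'; f c1 z; f c2 z].
have xBgf : ~ divides x Bgf.
  move=> /mpoly1_divX Bgf0.
  pose Bkf := Bz \mPo [tuple (t c1 z')%:MP; (t c2 z')%:MP; f c1 z; f c2 z].
  have xBkf : divides x Bkf.
    apply/mpoly1_divX; rewrite -[RHS]Bgf0 !comp_mpoly_meval; apply: meval_eq.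
    by case=> [[|[|[|[|i]]]]] // hi; rewrite !(tnth_nth 0) /= ?mevalC ?ev_f.
  have xdet : divides x ((t c1 z')%:MP * f c2 z - (t c2 z')%:MP * f c1 z).
    apply/mpoly1_divX; rewrite rmorphB !rmorphM /= !mevalC !ev_f.
    have -> : t c1 z' * t c2 z - t c2 z' * t c1 z = (z - z') * cubic c1 c2 v1 v2.
      by rewrite /t /conic /cubic; ring.
    by rewrite D0 mulr0.
  have xM : divides (x ^+ 2) ((A z')%:MP * (b \mPo [tuple f c1 z; f c2 z])
                              - (a \mPo [tuple f c1 z; f c2 z]) * (B z')%:MP).
    rewrite /A /B -!comp2_const BzE -/Bkf.
    have [p ->] := xdet; have [q ->] := xBkf.
    by exists (p * q); rewrite expr2 mulrACA.
  have [u uE] : divides (x ^+ 2)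
      ((a \mPo [tuple f c1 z; f c2 z]) * y2 - (b \mPo [tuple f c1 z; f c2 z]) * y1).
    by have [u ->] := hP z; exists (x ^+ e * u); rewrite mulrA -exprD.
  have [p pE] := xM.
  have AB' : (A z')%:MP * v2%:MP = (B z')%:MP * v1%:MP :> {mpoly F[1]}.
    by rewrite -!mpolyCM AB.
  (* By [AB], [k * x = A z' * y2 - B z' * y1]. If [k] vanished, [(A z', B z')] would be proportional
     to both [v] and [w], hence zero. *)
  pose k := A z' * w2 - B z' * w1.
  have k0 : k != 0.
    apply/eqP => k0; apply: (ab _ _ tz').
      apply: (mulIf vw); rewrite mul0r.
      transitivity (v1 * k + w1 * (B z' * v1 - A z' * v2)); first by rewrite /k /A /B; ring.
      by rewrite k0 AB subrr !mulr0 addr0.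
    apply: (mulIf vw); rewrite mul0r.
    transitivity (v2 * k + w2 * (B z' * v1 - A z' * v2)); first by rewrite /k /A /B; ring.
    by rewrite k0 AB subrr !mulr0 addr0.
  have cancel (q r : {mpoly F[1]}) : k%:MP * (x * q) = x ^+ 2 * r -> q.@[fun=> 0] = 0.
    move=> E; apply/mpoly1_divX; exists ((k^-1)%:MP * r).
    apply: (mulfI x0); rewrite mulrA -expr2 mulrCA -E mulrA -mpolyCM mulVf //.
    by rewrite mul1r.
  have kE : k%:MP = (A z')%:MP * w2%:MP - (B z')%:MP * w1%:MP :> {mpoly F[1]}.
    by rewrite /k mpolyCB !mpolyCM.
  (* With [a] and [b] taken at [z], [A z' * (a * y2 - b * y1) + y1 * (A z' * b - a * B z')] equals
     [k * x * a], and both brackets are divisible by [x ^+ 2]. For [b] the multiplier [y1] becomes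
     [y2]. *)
  apply: (ab _ _ tz).
    rewrite -[LHS]ev_a; apply: (cancel _ ((A z')%:MP * u + y1 * p)).
    rewrite mulrDr [x ^+ 2 * (_ * u)]mulrCA -uE [x ^+ 2 * (y1 * p)]mulrCA -pE kE /y1 /y2.
    apply/eqP; rewrite -subr_eq0; apply/eqP.
    transitivity ((a \mPo [tuple f c1 z; f c2 z]) *
      ((B z')%:MP * v1%:MP - (A z')%:MP * v2%:MP)); first by ring.
    by rewrite AB' subrr mulr0.
  rewrite -[LHS]ev_b; apply: (cancel _ ((B z')%:MP * u + y2 * p)).
  rewrite mulrDr [x ^+ 2 * (_ * u)]mulrCA -uE [x ^+ 2 * (y2 * p)]mulrCA -pE kE /y1 /y2.
  apply/eqP; rewrite -subr_eq0; apply/eqP.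
  transitivity ((b \mPo [tuple f c1 z; f c2 z]) *
    ((B z')%:MP * v1%:MP - (A z')%:MP * v2%:MP)); first by ring.
  by rewrite AB' subrr mulr0.
(* The determinant of the pencil values at [z'] and [z] is [z - z'] times the cubic. Cramer's rule
   makes the Bezoutian difference divisible after multiplication by [y1] or [y2], one of which is
   nonzero at [x = 0]. *)
have /(prime_power_divides x0 xP xBgf)[u uE] : divides (x ^+ e.+2)
    (Bgf * ((z - z')%:MP * cubic (mpC 1 c1) (mpC 1 c2) y1 y2)).
  have -> : Bgf * ((z - z')%:MP * cubic (mpC 1 c1) (mpC 1 c2) y1 y2) =
      (a \mPo [tuple f c1 z'; f c2 z']) * (b \mPo [tuple f c1 z; f c2 z])
      - (a \mPo [tuple f c1 z; f c2 z]) * (b \mPo [tuple f c1 z'; f c2 z']).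
    by rewrite BzE -/Bgf mpolyCB /f /conic /cubic; ring.
  have v0 : (v1, v2) != (0, 0).
    by apply: contraNneq vw => -[-> ->]; rewrite !mul0r subrr.
  have [p pE] := hP z; have [q qE] := hP z'.
  apply: pt2_eq0 v0 => vi.
    apply: (@prime_power_divides _ x y1) => //.
      by move=> /mpoly1_divX; rewrite ev_y1 => /eqP; rewrite (negbTE vi).
    by eexists; have [-> _] := cross_elimination pE qE.
  apply: (@prime_power_divides _ x y2) => //.
    by move=> /mpoly1_divX; rewrite ev_y2 => /eqP; rewrite (negbTE vi).
  by eexists; have [_ ->] := cross_elimination pE qE.
exists (((z - z')^-1)%:MP * u); rewrite mulrCA -uE mulrA -mpolyCM mulVf ?mul1r //.
by rewrite subr_eq0.
Qed.

(* The line joining (0 : 0 : 1) to (s : t : 0) meets the conic [x F2 = y F1] again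
   at (s lam : t lam : - kap). *)
Definition lam (A : comNzRingType) (c1 c2 : nat -> A) (x y s t : A) : A :=
  x * lpart c2 s t - y * lpart c1 s t.

Definition kap (A : comNzRingType) (c1 c2 : nat -> A) (x y s t : A) : A :=
  x * qpart c2 s t - y * qpart c1 s t.

Lemma comp_lam (R : comNzRingType) n m (c1 c2 : nat -> R) (x y s t : {mpoly R[n]})
    (h : n.-tuple {mpoly R[m]}) :
  lam (mpC n c1) (mpC n c2) x y s t \mPo h
  = lam (mpC m c1) (mpC m c2) (x \mPo h) (y \mPo h) (s \mPo h) (t \mPo h).
Proof. by rewrite !(rmorphB, rmorphD, rmorphM) /= !comp_mpolyC. Qed.

Lemma comp_kap (R : comNzRingType) n m (c1 c2 : nat -> R) (x y s t : {mpoly R[n]})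
    (h : n.-tuple {mpoly R[m]}) :
  kap (mpC n c1) (mpC n c2) x y s t \mPo h
  = kap (mpC m c1) (mpC m c2) (x \mPo h) (y \mPo h) (s \mPo h) (t \mPo h).
Proof. by rewrite !(rmorphB, rmorphD, rmorphM, rmorphXn) /= !comp_mpolyC. Qed.

Lemma meval_lam (R : comNzRingType) n (c1 c2 : nat -> R) (x y s t : {mpoly R[n]})
    (v : 'I_n -> R) :
  (lam (mpC n c1) (mpC n c2) x y s t).@[v]
  = lam c1 c2 x.@[v] y.@[v] s.@[v] t.@[v].
Proof. by rewrite !(rmorphB, rmorphD, rmorphM) /= !mevalC. Qed.

Lemma meval_kap (R : comNzRingType) n (c1 c2 : nat -> R) (x y s t : {mpoly R[n]})
    (v : 'I_n -> R) :
  (kap (mpC n c1) (mpC n c2) x y s t).@[v]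
  = kap c1 c2 x.@[v] y.@[v] s.@[v] t.@[v].
Proof. by rewrite !(rmorphB, rmorphD, rmorphM, rmorphXn) /= !mevalC. Qed.

Lemma dhomog_mpC (R : comNzRingType) n (c : nat -> R) i (p : {mpoly R[n]}) d :
  p \is d.-homog -> mpC n c i * p \is d.-homog.
Proof. by move=> hp; rewrite mul_mpolyC; apply: rpredZ. Qed.

Lemma lpart_homog (R : comNzRingType) n (c : nat -> R) (s t : {mpoly R[n]}) d :
  s \is d.-homog -> t \is d.-homog -> lpart (mpC n c) s t \is d.-homog.
Proof. by move=> hs ht; apply: rpredD; apply: dhomog_mpC. Qed.

Lemma qpart_homog (R : comNzRingType) n (c : nat -> R) (s t : {mpoly R[n]}) d :
  s \is d.-homog -> t \is d.-homog -> qpart (mpC n c) s t \is (d + d).-homog.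
Proof.
move=> hs ht; rewrite /qpart !expr2.
by apply: rpredD; [apply: rpredD|]; apply/dhomog_mpC/dhomogM.
Qed.

Lemma cubic_homog (R : comNzRingType) n (c1 c2 : nat -> R) (s t : {mpoly R[n]}) :
  s \is 1.-homog -> t \is 1.-homog ->
  cubic (mpC n c1) (mpC n c2) s t \is 3.-homog.
Proof.
move=> hs ht; rewrite -[3%N]/(1 + (1 + 1))%N.
by apply: rpredB; apply: dhomogM; by [apply: lpart_homog|apply: qpart_homog].
Qed.

Lemma linear_forms_common_zero (F : fieldType) (l l' : {mpoly F[2]}) (x y : F) :
  l \is 1.-homog -> l' \is 1.-homog -> l' != 0 -> (x, y) != (0, 0) ->
  l.@[pt2 x y] = 0 -> l'.@[pt2 x y] = 0 -> divides l' l.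
Proof.
move=> hl hl' l'0 xy lxy l'xy.
have [q /dhomog0_const[u ->] ->] := binary_form_factor hl xy lxy.
have [q' /dhomog0_const[u' q'E] l'E] := binary_form_factor hl' xy l'xy.
have u'0 : u' != 0 by apply: contraNneq l'0 => u'0; rewrite l'E q'E u'0 mulr0.
exists (u'^-1 * u)%:MP; rewrite l'E q'E -mulrA -mpolyCM mulrA mulfV //.
by rewrite mul1r.
Qed.

Lemma divides_constM (F : fieldType) n (V p : {mpoly F[n]}) (c : F) :
  c != 0 -> divides V (c%:MP * p) -> divides V p.
Proof.
move=> c0 [u cu]; exists ((c^-1)%:MP * u).
by rewrite mulrCA -cu mulrA -mpolyCM mulVf // mul1r.
Qed.

(** Each entry of [s] is tried once, so an entry of [s1] may well divide [G] again; excluding this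
    for the lines of the cubic is a separate task. *)
Lemma strip_factors (R : comUnitRingType) (I : eqType) (f : I -> R) (s : seq I) (P : R) :
  exists G s1 s2, [/\ P = G * \prod_(i <- s1) f i, perm_eq s (s1 ++ s2) &
                      forall i, i \in s2 -> ~ divides (f i) G].
Proof.
elim: s => [|i s [G [s1 [s2 [PE sE h2]]]]].
  by exists P, [::], [::]; rewrite big_nil mulr1.
have [[G' GE]|iG] := classic (divides (f i) G).
  exists G', (i :: s1), s2; split=> [||j js2 jG'].
  - by rewrite big_cons PE GE; ring.
  - by rewrite /= perm_cons.
  by apply: (h2 j js2); rewrite GE; apply: dividesMl.
exists G, s1, (i :: s2); split=> //.
  by rewrite perm_sym perm_catC /= perm_cons perm_catC perm_sym.
by move=> j; rewrite inE => /orP[/eqP->|/h2].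
Qed.

Lemma mpoly_extract_power (F : fieldType) n (x p : {mpoly F[n]}) :
  x \is 1.-homog -> x != 0 -> p != 0 -> exists j u, p = x ^+ j * u /\ ~ divides x u.
Proof.
move=> hx x0; have [k] := ubnP (msize p); elim: k p => // k IHk p pk p0.
have [[q pE]|xp] := classic (divides x p); last by exists 0%N, p; rewrite mul1r.
have q0 : q != 0 by apply: contraNneq p0 => q0; rewrite pE q0 mulr0.
have [|//|j [u [qE xu]]] := IHk q.
  move: pk; rewrite pE msizeM // (msize_dhomog x0 hx).
  exact.
by exists j.+1, u; rewrite pE qE exprS mulrA.
Qed.

Lemma comp_implicit_form (F : closedFieldType) n (a b : {mpoly F[2]})
    (f1 f2 : {mpoly F[3]}) (x y z u v : {mpoly F[n]}) :
  f1 \mPo [tuple x; y; z] = u -> f2 \mPo [tuple x; y; z] = v ->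
  implicit_form a b f1 f2 \mPo [tuple x; y; z] =
  (a \mPo [tuple u; v]) * y - (b \mPo [tuple u; v]) * x.
Proof. by move=> <- <-; rewrite rmorphB !rmorphM /= !comp2A !comp_mpolyXU. Qed.

(** * The polynomial [P] and its parametrization, for a pencil in normal form *)

Section RationalCurve.

Variables (F : closedFieldType) (d : nat) (a b : {mpoly F[2]}) (c1 c2 : nat -> F).

Hypothesis ab : coprime_forms d a b.
Hypothesis d_gt1 : (1 < d)%N.

Let F1 : {mpoly F[3]} := conic (mpC 3 c1) 'X_0 'X_1 'X_2.
Let F2 : {mpoly F[3]} := conic (mpC 3 c2) 'X_0 'X_1 'X_2.
Let P := implicit_form a b F1 F2.
Let D2 : {mpoly F[2]} := cubic (mpC 2 c1) (mpC 2 c2) 'X_0 'X_1.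
Let D3 : {mpoly F[3]} := cubic (mpC 3 c1) (mpC 3 c2) 'X_0 'X_1.
Let lamT : {mpoly F[2]} := lam (mpC 2 c1) (mpC 2 c2) 'X_0 'X_1 a b.
Let kapT : {mpoly F[2]} := kap (mpC 2 c1) (mpC 2 c2) 'X_0 'X_1 a b.
Let phi : 3.-tuple {mpoly F[2]} := [tuple a * lamT; b * lamT; - kapT].
Let aF := a \mPo [tuple F1; F2].
Let bF := b \mPo [tuple F1; F2].

Hypothesis D2_neq0 : D2 != 0.
Hypothesis lam_neq0 : lamT != 0.
Hypothesis base_free : forall v1 v2 : F, (v1, v2) != (0, 0) ->
  (lpart c1 v1 v2, qpart c1 v1 v2) != (0, 0) \/
  (lpart c2 v1 v2, qpart c2 v1 v2) != (0, 0).

Lemma PE : P = aF * 'X_1 - bF * 'X_0.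
Proof. by []. Qed.

Lemma conic_homog (c : nat -> F) : conic (mpC 3 c) 'X_0 'X_1 'X_2 \is 2.-homog.
Proof.
apply: rpredD; rewrite -[2%N]/(1 + 1)%N.
  by apply: dhomogM; [|apply: lpart_homog]; apply: mpolyX_linear.
by apply: qpart_homog; apply: mpolyX_linear.
Qed.

Lemma P_homog : P \is (2 * d.+1 + 1).-homog.
Proof.
have [ha hb _] := ab.
have hF : forall i, tnth [tuple F1; F2] i \is 2.-homog.
  by apply: forall_ord2; apply: conic_homog.
by apply: rpredB; apply: dhomogM; by [apply: comp_dhomog|apply: mpolyX_linear].
Qed.

Lemma phi_homog i : tnth phi i \is (d.+1 + (1 + d.+1)).-homog.
Proof.
have [ha hb _] := ab.
have hl : lamT \is (1 + d.+1).-homog.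
  by apply: rpredB; apply: dhomogM; by [apply: mpolyX_linear|apply: lpart_homog].
move: i; apply: forall_ord3; rewrite (tnth_nth 0) /=; [exact: dhomogM|exact: dhomogM|].
rewrite rpredN addnCA.
by apply: rpredB; apply: dhomogM; by [apply: mpolyX_linear|apply: qpart_homog].
Qed.

(** The bracket is [lamT * qpart - kapT * lpart]. For [F1] and for [F2] one of the two variables
    cancels in it, and the other times the cubic at [(a, b)] remains. *)
Lemma conic_on_phi (c : nat -> F) : conic (mpC 3 c) 'X_0 'X_1 'X_2 \mPo phi =
  lamT * (conic (mpC 2 c) a b (- kapT)
          + (lamT - 1) * qpart (mpC 2 c) a b).
Proof.
rewrite comp_conic !comp_mpolyXU /= /conic /lpart /qpart; ring.
Qed.

Lemma F1_on_phi : F1 \mPo phi = 'X_0 * (lamT * (D2 \mPo [tuple a; b])).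
Proof.
rewrite conic_on_phi comp_cubic !comp_mpolyXU /= /lamT /kapT.
by rewrite /conic /cubic /lam /kap; ring.
Qed.

Lemma F2_on_phi : F2 \mPo phi = 'X_1 * (lamT * (D2 \mPo [tuple a; b])).
Proof.
rewrite conic_on_phi comp_cubic !comp_mpolyXU /= /lamT /kapT.
by rewrite /conic /cubic /lam /kap; ring.
Qed.

Lemma P_on_phi : P \mPo phi = 0.
Proof.
have [ha hb _] := ab.
rewrite [LHS](comp_implicit_form a b F1_on_phi F2_on_phi).
rewrite ![_ * (lamT * _)]mulrC (comp2_scale _ _ _ ha) (comp2_scale _ _ _ hb).
by rewrite !comp2_id; ring.
Qed.

Lemma D3_comp : D3 = D2 \mPo [tuple 'X_0; 'X_1].
Proof. by rewrite comp_cubic !comp_mpolyXU. Qed.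

Lemma cubic_pencil : F1 * lpart (mpC 3 c2) 'X_0 'X_1 - F2 * lpart (mpC 3 c1) 'X_0 'X_1 = D3.
Proof. by rewrite /F1 /F2 /D3 /conic /cubic; ring. Qed.

(** Modulo [P] the pairs [(aF, bF)] and [('X_0, 'X_1)] are proportional. Since [lam] is linear and
    [kap] quadratic in this pair, their values at [('X_0, 'X_1)] suffice, and these are [D3] and
    [- D3 * 'X_2]. *)
Lemma parametrization_eqmod i :
  divides P (aF ^+ 2 * D3 * 'X_i - 'X_0 ^+ 2 * (tnth phi i \mPo [tuple F1; F2])) /\
  divides P (bF ^+ 2 * D3 * 'X_i - 'X_1 ^+ 2 * (tnth phi i \mPo [tuple F1; F2])).
Proof.
have compl : lamT \mPo [tuple F1; F2] = lam (mpC 3 c1) (mpC 3 c2) F1 F2 aF bF.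
  by rewrite comp_lam !comp_mpolyXU.
have compk : kapT \mPo [tuple F1; F2] = kap (mpC 3 c1) (mpC 3 c2) F1 F2 aF bF.
  by rewrite comp_kap !comp_mpolyXU.
have D3k : D3 * 'X_2 = - kap (mpC 3 c1) (mpC 3 c2) F1 F2 'X_0 'X_1.
  by rewrite /F1 /F2 /D3 /conic /cubic /kap; ring.
have E1 : aF * D3 - 'X_0 * (lamT \mPo [tuple F1; F2]) =
    P * (F1 * mpC 3 c2 1%N - F2 * mpC 3 c1 1%N).
  by rewrite compl -cubic_pencil PE /lam /lpart; ring.
have E2 : bF * D3 - 'X_1 * (lamT \mPo [tuple F1; F2]) =
    P * (F2 * mpC 3 c1 0%N - F1 * mpC 3 c2 0%N).
  by rewrite compl -cubic_pencil PE /lam /lpart; ring.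
move: i; apply: forall_ord3; rewrite (tnth_nth 0) /= ?rmorphM ?rmorphN /= -/aF -/bF.
- split.
    exists (aF * 'X_0 * (F1 * mpC 3 c2 1%N - F2 * mpC 3 c1 1%N)).
    by rewrite [RHS]mulrCA -E1; ring.
  exists (bF * 'X_0 * (F2 * mpC 3 c1 0%N - F1 * mpC 3 c2 0%N)
          - 'X_1 * (lamT \mPo [tuple F1; F2])).
  by rewrite [RHS]mulrBr [P * (_ * _ * _)]mulrCA -E2 PE; ring.
- split.
    exists (aF * D3 + 'X_0 * bF * (F1 * mpC 3 c2 1%N - F2 * mpC 3 c1 1%N)).
    by rewrite [RHS]mulrDr [P * (_ * _ * _)]mulrCA -E1 PE; ring.
  exists (bF * 'X_1 * (F2 * mpC 3 c1 0%N - F1 * mpC 3 c2 0%N)).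
  by rewrite [RHS]mulrCA -E2; ring.
rewrite compk -!(mulrA _ D3) D3k; split.
  exists (F2 * (mpC 3 c1 3 * aF * 'X_0 + mpC 3 c1 4 * (aF * 'X_1 + bF * 'X_0))
          - F1 * (mpC 3 c2 3 * aF * 'X_0 + mpC 3 c2 4 * (aF * 'X_1 + bF * 'X_0))).
  by rewrite PE /kap /qpart; ring.
exists (F1 * (mpC 3 c2 3 * bF * 'X_1 + mpC 3 c2 2 * (aF * 'X_1 + bF * 'X_0))
        - F2 * (mpC 3 c1 3 * bF * 'X_1 + mpC 3 c1 2 * (aF * 'X_1 + bF * 'X_0))).
by rewrite PE /kap /qpart; ring.
Qed.

(* Modulo [P], the points [aF ^+ 2 * D3 * X] and ['X_0 ^+ 2 * phi(F)] agree, and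
   [U] vanishes at the latter. *)
Lemma vanishing_on_phi (U : {mpoly F[3]}) k : U \is k.-homog -> U \mPo phi = 0 ->
  divides P ((aF ^+ 2 * D3) ^+ k * U) /\ divides P ((bF ^+ 2 * D3) ^+ k * U).
Proof.
move=> hU U0.
have key c x : (forall i, divides P (c * 'X_i - x * (tnth phi i \mPo [tuple F1; F2]))) ->
    divides P (c ^+ k * U).
  move=> hc.
  have cE : U \mPo [tuple c * 'X_i | i < 3] = c ^+ k * U.
    rewrite (@comp_dhomogZ _ _ _ _ _ c [tuple 'X_i | i < 3] _ hU) ?comp_mpoly_id //.
    by move=> i; rewrite !tnth_mktuple.
  have xE : U \mPo [tuple x * (tnth phi i \mPo [tuple F1; F2]) | i < 3] = 0.
    rewrite (@comp_dhomogZ _ _ _ _ _ x [tuple tnth phi i \mPo [tuple F1; F2] | i < 3] _ hU).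
      by rewrite -comp_mpolyA U0 comp_mpoly0 mulr0.
    by move=> i; rewrite !tnth_mktuple.
  rewrite -[X in divides _ X]subr0 -{1}cE -xE.
  by apply: comp_mpoly_eqmod => i; rewrite !tnth_mktuple.
split; [apply: (key _ ('X_0 ^+ 2))|apply: (key _ ('X_1 ^+ 2))] => i;
  by have [] := parametrization_eqmod i.
Qed.

(** * Removing lines through (0 : 0 : 1) *)

Let lift (l : {mpoly F[2]}) : {mpoly F[3]} := l \mPo [tuple 'X_0; 'X_1].

Lemma lift_homog l : l \is 1.-homog -> lift l \is 1.-homog.
Proof.
move=> hl; rewrite -[1%N]/(1 * 1)%N; apply: comp_dhomog => //.
by apply: forall_ord2; apply: mpolyX_linear.
Qed.

Lemma lift_neq0 l : l != 0 -> lift l != 0.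
Proof.
apply: contraNneq => l0; rewrite -(comp2_id l).
have := congr1 (comp_mpoly [tuple 'X_0; 'X_1; 0 : {mpoly F[2]}]) l0.
by rewrite comp2A !comp_mpolyXU comp_mpoly0 => ->.
Qed.

(** Restrict to the member of the pencil over (x : 1), where [lamT] does not vanish, parametrized by
    the lines through (0 : 0 : 1). There [(F1, F2)] is proportional to [(x, 1)], so up to sign [P]
    becomes a product of powers of [l] and [D2] with [line_through a0 b0]. *)
Lemma P_neq0 : P != 0.
Proof.
have [ha hb _] := ab.
have hl : lamT \is (1 + d.+1).-homog.
  by apply: rpredB; apply: dhomogM; by [apply: mpolyX_linear|apply: lpart_homog].
have [x lx] := binary_form_nonroot hl lam_neq0.
set a0 := a.@[pt2 x 1]; set b0 := b.@[pt2 x 1].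
have lxE : lamT.@[pt2 x 1] = lam c1 c2 x 1 a0 b0.
  by rewrite meval_lam !mevalXU.
have ab0 : (a0, b0) != (0, 0).
  apply: contraNneq lx => -[a00 b00]; rewrite lxE a00 b00.
  by rewrite /lam /lpart; apply/eqP; ring.
pose l : {mpoly F[2]} := lam (mpC 2 c1) (mpC 2 c2) x%:MP 1 'X_0 'X_1.
pose q : {mpoly F[2]} := kap (mpC 2 c1) (mpC 2 c2) x%:MP 1 'X_0 'X_1.
have l0 : l != 0.
  apply: contraNneq lx => l0; rewrite lxE.
  have := congr1 (meval (pt2 a0 b0)) l0.
  by rewrite meval_lam !mevalXU mevalC meval1 meval0 => ->.
have FE : F1 \mPo [tuple 'X_0 * l; 'X_1 * l; - q] = (l * D2) * x%:MP /\
          F2 \mPo [tuple 'X_0 * l; 'X_1 * l; - q] = (l * D2) * 1%:MP.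
  rewrite !comp_conic !comp_mpolyXU /= mpolyC1 /l /q /D2 /lam /kap /conic /cubic /lpart /qpart.
  by split; ring.
apply/eqP => P0.
have := congr1 (comp_mpoly [tuple 'X_0 * l; 'X_1 * l; - q]) P0.
rewrite comp_mpoly0 [X in X = _](comp_implicit_form a b FE.1 FE.2).
rewrite (comp2_scale _ _ _ ha) (comp2_scale _ _ _ hb) !comp2_const -/a0 -/b0.
move=> E.
have : (l * D2) ^+ d.+1 * (l * line_through a0 b0) = 0.
  apply: oppr_inj; rewrite oppr0 -[RHS]E /line_through; ring.
apply/eqP/(mulf_neq0 (expf_neq0 _ (mulf_neq0 l0 D2_neq0)) (mulf_neq0 l0 _)).
exact: line_through_neq0.
Qed.

(** If [l] still divided [G], then transversally to [l] the order of [P] would exceed that of the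
    product over [ls1]. By the multiplicity bound the order of [D2] exceeds it too, so a factor of
    [D2] in [ls2] is proportional to [l] and divides [G], against the choice of [ls2]. *)
Lemma line_not_divides c0 ls1 ls2 G :
  c0 != 0 -> D2 = c0%:MP * \prod_(l <- ls1 ++ ls2) l ->
  (forall l, l \in ls1 ++ ls2 -> l \is 1.-homog /\ l != 0) ->
  P = G * \prod_(l <- ls1) lift l ->
  (forall l, l \in ls2 -> ~ divides (lift l) G) ->
  forall l, l \in ls1 -> ~ divides (lift l) G.
Proof.
move=> c00 D2E lin PE' h2 l ll1 [G' GE].
have [hl l0] : l \is 1.-homog /\ l != 0 by apply: lin; rewrite mem_cat ll1.
have [x [y lE]] := binary_linear_formE hl.
have xy : (x, y) != (0, 0).
  by apply: contraNneq l0 => -[x0 y0]; rewrite lE x0 y0 mpolyC0 !mul0r addr0.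
have yx : (- y, x) != (0, 0) by rewrite xpair_eqE oppr_eq0 andbC -xpair_eqE.
have l_yx : l.@[pt2 (- y) x] = 0.
  rewrite lE rmorphD !rmorphM /= !mevalC !mevalXU /pt2 /=; ring.
have [w1 [w2 vw]] : exists w1 w2, - y * w2 - x * w1 != 0.
  apply: pt2_eq0 xy => [x0|y0].
    by exists 1, 0; rewrite mulr0 mulr1 sub0r oppr_eq0.
  by exists 0, 1; rewrite mulr0 mulr1 subr0 oppr_eq0.
pose X : {mpoly F[1]} := 'X_0.
have hX : X \is 1.-homog by apply: mpolyX_linear.
have X0 : X != 0 by apply: mpolyX_neq0.
have XP : prime_elt X by apply: linear_form_prime.
(* A direction moving with [X]: at [X = 0] it is the zero of [l], and [w] is transversal to it. *)
pose y1 := (- y)%:MP + w1%:MP * X; pose y2 := x%:MP + w2%:MP * X.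
pose eta (p : {mpoly F[2]}) := p \mPo [tuple y1; y2].
have eta_linear (l' : {mpoly F[2]}) : l' \is 1.-homog ->
    eta l' = (l'.@[pt2 (- y) x])%:MP + (l'.@[pt2 w1 w2])%:MP * X.
  move=> /binary_linear_formE[x' [y' ->]].
  rewrite /eta !rmorphD !rmorphM /= !mevalC !mevalXU !comp_mpolyC !comp_mpolyXU /=.
  by rewrite /pt2 /= /y1 /y2 !(mpolyCD, mpolyCM, mpolyCN); ring.
have eta_neq0 (l' : {mpoly F[2]}) : l' \is 1.-homog -> l' != 0 -> eta l' != 0.
  move=> hl' l'0; apply/eqP => eta0.
  have l'v : l'.@[pt2 (- y) x] = 0.
    have := congr1 (meval (fun=> 0)) eta0.
    by rewrite meval0 eta_linear // rmorphD rmorphM /= !mevalC mevalXU mulr0 addr0.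
  have l'w : l'.@[pt2 w1 w2] = 0.
    have := congr1 (meval (fun=> 1)) eta0.
    by rewrite meval0 eta_linear // rmorphD rmorphM /= !mevalC mevalXU mulr1 l'v add0r.
  have [q /dhomog0_const[u ->] l'E] := binary_form_factor hl' yx l'v.
  move: l'w; rewrite l'E rmorphM rmorphB !rmorphM /= !mevalC !mevalXU /pt2 /=.
  move=> /eqP; rewrite mulf_eq0 => /orP[/eqP vw0|/eqP u0].
    by case/eqP: vw; rewrite -[RHS]oppr0 -vw0; ring.
  by case/eqP: l'0; rewrite l'E u0 mpolyC0 mulr0.
have lX : divides X (eta l).
  by rewrite eta_linear // l_yx mpolyC0 add0r; apply/dividesMl/divides_refl.
have prod_neq0 : \prod_(l' <- ls1) eta l' != 0.
  rewrite prodf_seq_neq0; apply/allP => l' l'1 /=.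
  by have [|hl' l'0] := lin l'; [rewrite mem_cat l'1|apply: eta_neq0].
have [j [u [uE Xu]]] := mpoly_extract_power hX X0 prod_neq0.
have hP z : divides (X ^+ j.+1)
    ((a \mPo [tuple conic (mpC 1 c1) y1 y2 z%:MP; conic (mpC 1 c2) y1 y2 z%:MP]) * y2
    - (b \mPo [tuple conic (mpC 1 c1) y1 y2 z%:MP; conic (mpC 1 c2) y1 y2 z%:MP]) * y1).
  have lift_eta l' : lift l' \mPo [tuple y1; y2; z%:MP] = eta l'.
    by rewrite comp2A !comp_mpolyXU.
  have FE c : conic (mpC 3 c) 'X_0 'X_1 'X_2 \mPo [tuple y1; y2; z%:MP] =
      conic (mpC 1 c) y1 y2 z%:MP by rewrite comp_conic !comp_mpolyXU.
  have := congr1 (comp_mpoly [tuple y1; y2; z%:MP]) PE'.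
  rewrite [X in X = _](comp_implicit_form a b (FE c1) (FE c2)) => ->.
  rewrite GE 2!rmorphM /= rmorph_prod /= lift_eta.
  under eq_bigr => l' _ do rewrite lift_eta.
  rewrite uE; have [q ->] := lX; exists (q * (G' \mPo [tuple y1; y2; z%:MP]) * u).
  by rewrite exprS; ring.
have D0 : cubic c1 c2 (- y) x = 0.
  have := meval_cubic c1 c2 'X_0 'X_1 (pt2 (- y) x).
  rewrite !mevalXU -/D2 D2E /pt2 /= => <-.
  rewrite rmorphM rmorph_prod /= big_cat /= (big_rem l) //= -/(pt2 _ _) l_yx.
  by rewrite !mul0r mulr0.
have := line_multiplicity_le_cubic ab vw D0 (base_free yx) hP.
have -> : cubic (mpC 1 c1) (mpC 1 c2) y1 y2 = eta D2.
  by rewrite /eta comp_cubic !comp_mpolyXU.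
have -> : eta D2 = X ^+ j * (c0%:MP * u * \prod_(l' <- ls2) eta l').
  rewrite D2E /eta rmorphM rmorph_prod /= comp_mpolyC big_cat /= uE; ring.
rewrite exprSr => /divides_cancel; rewrite expf_neq0 // => /(_ isT) /XP[].
  by move=> /(divides_constM c00).
move=> Xl2; have [|p] := @prime_elt_prod _ X [seq eta l' | l' <- ls2] (dhomogS_nunit hX) XP.
  by rewrite big_map.
move=> /mapP[l' l'2 ->]; have [|hl' l'0] := lin l'; first by rewrite mem_cat l'2 orbT.
rewrite mpoly1_divX eta_linear // rmorphD rmorphM /= !mevalC mevalXU mulr0 addr0 => l'v.
apply: (h2 l' l'2); rewrite GE; apply: dividesMr.
have [q qE] := linear_forms_common_zero hl hl' l'0 yx l_yx l'v.
by exists (lift q); rewrite /lift qE rmorphM.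
Qed.

Lemma factorization : exists c0 ls1 ls2 G,
  [/\ c0 != 0, D2 = c0%:MP * \prod_(l <- ls1 ++ ls2) l & size (ls1 ++ ls2) = 3%N] /\
  [/\ forall l, l \in ls1 ++ ls2 -> l \is 1.-homog /\ l != 0,
      P = G * \prod_(l <- ls1) lift l &
      forall l, l \in ls1 ++ ls2 -> ~ divides (lift l) G].
Proof.
have hD : D2 \is 3.-homog by apply: cubic_homog; apply: mpolyX_linear.
have [c0 [ls [c00 ls3 D2E lin]]] := binary_form_split hD D2_neq0.
have [G [ls1 [ls2 [PE' lsE h2]]]] := strip_factors lift ls P.
have D2E' : D2 = c0%:MP * \prod_(l <- ls1 ++ ls2) l by rewrite D2E (perm_big _ lsE).
have lin' l : l \in ls1 ++ ls2 -> l \is 1.-homog /\ l != 0.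
  by rewrite -(perm_mem lsE); apply: lin.
exists c0, ls1, ls2, G; split; split=> //; first by rewrite -(perm_size lsE).
move=> l; rewrite mem_cat => /orP[|/h2//].
exact: (line_not_divides c00 D2E' lin' PE' h2).
Qed.

(** Linear factors of [a] and of [b] give independent members of the pencil, whose ideal contains
    [D3]. Multiplying these ideals over all factors puts a power of [D3] into the ideal of [aF] and
    [bF], then into that of their powers. *)
Lemma cubic_combination m :
  exists N u v, D3 ^+ N = u * aF ^+ m + v * bF ^+ m.
Proof.
have [ha hb nz] := ab.
have a0 : a != 0.
  have [x [y [xy bxy]]] := binary_form_root hb.
  by apply/eqP => a0; apply: (nz x y xy) => //; rewrite a0 meval0.
have b0 : b != 0.
  have [x [y [xy axy]]] := binary_form_root ha.
  by apply/eqP => b0; apply: (nz x y xy) => //; rewrite b0 meval0.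
have [ca [la [ca0 _ aE hla]]] := binary_form_split ha a0.
have [cb [lb [cb0 _ bE hlb]]] := binary_form_split hb b0.
pose onF (l : {mpoly F[2]}) := l \mPo [tuple F1; F2].
have lines l l' : l \in la -> l' \in lb -> exists u v, D3 = u * onF l + v * onF l'.
  move=> lla ll'b; have [[hl l0] [hl' l'0]] := (hla l lla, hlb l' ll'b).
  have [x [y lE]] := binary_linear_formE hl.
  have [x' [y' l'E]] := binary_linear_formE hl'.
  have xy : (- y, x) != (0, 0).
    apply: contraNneq l0 => -[/eqP]; rewrite oppr_eq0 => /eqP y0 x0.
    by rewrite lE x0 y0 mpolyC0 !mul0r addr0.
  (* Otherwise the zero of [l] would be one of [l'] as well, and [a] and [b] would share it. *)
  have det : x * y' - x' * y != 0.
    apply/eqP => det; apply: (nz (- y) x xy).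
      rewrite aE (big_rem l) //= !rmorphM /= lE rmorphD !rmorphM /= !mevalC !mevalXU.
      by rewrite /pt2 /=; ring.
    rewrite bE (big_rem l') //= !rmorphM /= l'E rmorphD !rmorphM /= !mevalC !mevalXU.
    rewrite [pt2 _ _ 0]/pt2 [pt2 _ _ 1]/pt2 /=.
    have -> : x' * - y + y' * x = 0 by rewrite -[RHS]det; ring.
    by rewrite mul0r mulr0.
  have E1 : (x * y' - x' * y)%:MP * F1 = y'%:MP * onF l - y%:MP * onF l'.
    rewrite /onF lE l'E !rmorphD !rmorphM /= !comp_mpolyC !comp_mpolyXU /=.
    by rewrite ?mpolyCB ?mpolyCM; ring.
  have E2 : (x * y' - x' * y)%:MP * F2 = x%:MP * onF l' - x'%:MP * onF l.
    rewrite /onF lE l'E !rmorphD !rmorphM /= !comp_mpolyC !comp_mpolyXU /=.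
    by rewrite ?mpolyCB ?mpolyCM; ring.
  have D3E : (x * y' - x' * y)%:MP * D3 =
      (y'%:MP * lpart (mpC 3 c2) 'X_0 'X_1 + x'%:MP * lpart (mpC 3 c1) 'X_0 'X_1) * onF l
      - (y%:MP * lpart (mpC 3 c2) 'X_0 'X_1 + x%:MP * lpart (mpC 3 c1) 'X_0 'X_1) * onF l'.
    by rewrite -cubic_pencil mulrBr !mulrA E1 E2; ring.
  exists ((x * y' - x' * y)^-1%:MP * (y'%:MP * lpart (mpC 3 c2) 'X_0 'X_1 + x'%:MP * lpart (mpC 3 c1) 'X_0 'X_1)).
  exists (- ((x * y' - x' * y)^-1%:MP * (y%:MP * lpart (mpC 3 c2) 'X_0 'X_1 + x%:MP * lpart (mpC 3 c1) 'X_0 'X_1))).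
  by rewrite mulNr -!mulrA -mulrBr -D3E mulrA -mpolyCM mulVf // mul1r.
have step1 l' : l' \in lb ->
    exists u v, D3 ^+ size la = u * onF l' + v * \prod_(l <- la) onF l.
  move=> l'b; have [|u [v uv]] := @combination_prod _ _ la onF (onF l') D3.
    by move=> l /lines; apply.
  by exists v, u; rewrite addrC.
have [u [v uv]] := combination_prod step1.
have aFE : aF = ca%:MP * \prod_(l <- la) onF l.
  by rewrite /aF {1}aE rmorphM rmorph_prod /= comp_mpolyC.
have bFE : bF = cb%:MP * \prod_(l <- lb) onF l.
  by rewrite /bF {1}bE rmorphM rmorph_prod /= comp_mpolyC.
have inC (c : F) : c != 0 -> (c^-1)%:MP * c%:MP = 1 :> {mpoly F[3]}.
  by move=> c_neq0; rewrite -mpolyCM mulVf.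
have uv' : exists u v, (D3 ^+ size la) ^+ size lb = u * aF + v * bF.
  exists (v * (ca^-1)%:MP), (u * (cb^-1)%:MP); rewrite uv aFE bFE.
  by rewrite -!mulrA !(mulrA (_ ^-1)%:MP) !inC // !mul1r addrC.
(* [combination_exp] raises one generator only, hence the exchange and the second use. *)
have [u1 [v1 uv1]] := combination_exp m uv'; rewrite addrC in uv1.
have [u2 [v2 uv2]] := combination_exp m (ex_intro _ v1 (ex_intro _ u1 uv1)).
by eexists _, v2, u2; rewrite addrC -uv2 -!exprM.
Qed.

(** * The factor [G] left after the removal of the lines *)

Variables (c0 : F) (ls1 ls2 : seq {mpoly F[2]}) (G : {mpoly F[3]}).
Hypothesis c0_neq0 : c0 != 0.
Hypothesis D2E : D2 = c0%:MP * \prod_(l <- ls1 ++ ls2) l.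
Hypothesis ls3 : size (ls1 ++ ls2) = 3%N.
Hypothesis lin : forall l, l \in ls1 ++ ls2 -> l \is 1.-homog /\ l != 0.
Hypothesis PGE : P = G * \prod_(l <- ls1) lift l.
Hypothesis lines_G : forall l, l \in ls1 ++ ls2 -> ~ divides (lift l) G.

Let E : {mpoly F[3]} := \prod_(l <- ls1) lift l.

Lemma lin1 l : l \in ls1 -> l \is 1.-homog /\ l != 0.
Proof. by move=> ll; apply: lin; rewrite mem_cat ll. Qed.

Lemma size_ls1 : (size ls1 <= 3)%N.
Proof. by rewrite -ls3 size_cat leq_addr. Qed.

Lemma lift_phi_neq0 l : l \is 1.-homog -> l != 0 -> lift l \mPo phi != 0.
Proof.
move=> hl l0; rewrite comp2A !comp_mpolyXU /= ![_ * lamT]mulrC (comp2_scale _ _ _ hl).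
by rewrite mulf_neq0 ?expf_neq0 // (coprime_forms_comp_neq0 ab hl l0).
Qed.

Lemma G_neq0 : G != 0.
Proof. by apply: contraNneq P_neq0 => G0; rewrite PGE G0 mul0r. Qed.

Lemma E_neq0 : E != 0.
Proof. by apply: contraNneq P_neq0 => E0; rewrite PGE -/E E0 mulr0. Qed.

Lemma E_homog : E \is (size ls1).-homog.
Proof.
rewrite /E; elim: ls1 lin1 => [|l s IHs] hs; first by rewrite big_nil dhomog1.
rewrite big_cons -[size (l :: s)]/(1 + size s)%N; apply: dhomogM.
  by apply: lift_homog; have [] := hs l (mem_head _ _).
by apply: IHs => k ks; apply: hs; rewrite inE ks orbT.
Qed.

Lemma G_homog : exists m, G \is m.-homog.
Proof. by apply: (dhomog_divides P_neq0 P_homog); exists E. Qed.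

Lemma msize_G : msize G = (2 * d.+1 + 2 - size ls1)%N.
Proof.
have [m hG] := G_homog.
have hP : P \is (m + size ls1).-homog by rewrite PGE; apply: dhomogM hG E_homog.
have := dhomog_uniq P_neq0 P_homog hP.
by rewrite (msize_dhomog G_neq0 hG); clear; lia.
Qed.

Lemma G_on_phi : G \mPo phi = 0.
Proof.
have /eqP := P_on_phi; rewrite -/P PGE rmorphM rmorph_prod /= mulf_eq0.
case/orP=> [/eqP//|]; rewrite prodf_seq_eq0 => /hasP[l /lin1[hl l0]] /= /idPn[].
exact: lift_phi_neq0.
Qed.

Lemma lifted_lines n : n \in [seq lift l | l <- ls1 ++ ls2] ->
  n != 0 /\ prime_elt n.
Proof.
move=> /mapP[l /lin[hl l0] ->]; have n0 := lift_neq0 l0; split=> //.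
exact: (linear_form_prime (lift_homog hl)).
Qed.

Lemma D3E : D3 = c0%:MP * \prod_(n <- [seq lift l | l <- ls1 ++ ls2]) n.
Proof. by rewrite D3_comp -/D2 D2E rmorphM rmorph_prod /= comp_mpolyC big_map. Qed.

(** In [vanishing_on_phi] the factor [U] cancels, so [V] divides powers of [aF] and [bF] times a
    power of [D3]. No line of [D3] divides [V], so the powers of [D3] drop out, and
    [cubic_combination] leaves [V] dividing 1. *)
Lemma cofactor_unit (U V : {mpoly F[3]}) : G = U * V -> U \mPo phi = 0 ->
  V \is a GRing.unit.
Proof.
move=> GE U0.
have UV0 : U * V != 0 by rewrite -GE G_neq0.
have [U_neq0 V_neq0] : U != 0 /\ V != 0.
  by move: UV0; rewrite mulf_eq0 negb_or => /andP[].
have [k hU] : exists k, U \is k.-homog.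
  have [m hG] := G_homog.
  by apply: (dhomog_divides G_neq0 hG); exists V.
have primes n : n \in [seq lift l | l <- ls1 ++ ls2] ->
    [/\ n != 0, prime_elt n & ~ divides n V].
  move=> ns; have [n0 nP] := lifted_lines ns; split=> // nV.
  move/mapP: ns => [l ll nE]; apply: (lines_G ll).
  by rewrite GE -nE; apply: dividesMl.
have no_lines M N : divides V (D3 ^+ N * M) -> divides V M.
  rewrite D3E exprMn -rmorphXn /= -mulrA => /divides_constM VM.
  by apply: (divides_coprime_prodX primes); apply: VM; rewrite expf_neq0.
have dvdV c : divides P ((c ^+ 2 * D3) ^+ k * U) -> divides V (c ^+ (2 * k)).
  rewrite PGE GE -/E -mulrA [_ * U]mulrC => /(divides_cancel U_neq0).
  rewrite exprMn -exprM [_ * D3 ^+ k]mulrC => VE; apply: (no_lines _ k).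
  by apply: divides_trans VE; exists E.
have [Va Vb] := vanishing_on_phi hU U0.
have [N [u [v uv]]] := cubic_combination (2 * k).
apply/divides1_unit/(no_lines _ N); rewrite mulr1 uv.
by apply: dividesD; apply: dividesMl; apply: dvdV.
Qed.

(** Substituting [phi] lands in a domain, so one of two factors vanishes along [phi] and the other
    is a unit. The degree of [G] is at least 2 * 3 + 1 - 3 = 4. *)
Lemma G_irreducible : irreducible_elt G.
Proof.
split=> [||U V GE]; first exact: G_neq0.
  by rewrite mpoly_unit_msize msize_G; move: size_ls1 d_gt1; clear; lia.
have /eqP := G_on_phi; rewrite GE rmorphM /= mulf_eq0 => /orP[] /eqP.
  by right; apply: cofactor_unit GE _.
by left; apply: (@cofactor_unit V U) => //; rewrite mulrC.
Qed.

(** No removed line divides an irreducible nonlinear [H], so these lines cancel and [H] divides the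
    irreducible [G]. *)
Lemma G_unique_nonlinear (H : {mpoly F[3]}) : irreducible_elt H -> divides H P ->
  (2 < msize H)%N -> associates H G.
Proof.
move=> [H0 HU Hirr] HP H2.
have : divides H G.
  apply: (@divides_coprime_prod _ _ _ [seq lift l | l <- ls1]).
    move=> n n1.
    have nls : n \in [seq lift l | l <- ls1 ++ ls2] by rewrite map_cat mem_cat n1.
    have [n0 nP] := lifted_lines nls; split=> // -[q HE].
    move/mapP: n1 => [l /lin1[hl l0] nE]; have hn := lift_homog hl.
    case: (Hirr n q HE) => [|qU].
      by rewrite nE (negbTE (dhomogS_nunit hn)).
    move: H2 qU; rewrite HE mpoly_unit_msize msizeM //; last first.
      by apply: contraNneq H0 => q0; rewrite HE q0 mulr0.
    by rewrite nE (msize_dhomog (lift_neq0 l0) hn) => H2 /eqP q1; rewrite q1 in H2.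
  by rewrite big_map -/E mulrC -PGE.
move=> [u GE]; have [_ _ /(_ H u GE)[/idPn//|uU]] := G_irreducible.
by exists u^-1; rewrite ?unitrV // GE mulrC mulrK.
Qed.

(** On a line through (0 : 0 : 1) that is not a line of [D2], with [X] vanishing at that point, both
    conics acquire a factor [X]. So [P] has order at least [d.+2], of which the removed lines
    account for exactly [size ls1]. As [d.+2] exceeds 3, some of the order is left to [G]. *)
Lemma G_through_001 : G.@[fun i : 'I_3 => if i == 2 then 1 else 0] = 0.
Proof.
have [ha hb _] := ab.
have hD : D2 \is 3.-homog by apply: cubic_homog; apply: mpolyX_linear.
have [w] := binary_form_nonroot hD D2_neq0.
rewrite D2E rmorphM rmorph_prod /= mulf_eq0 negb_or => /andP[_].
rewrite prodf_seq_neq0 => /allP lw.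
pose X : {mpoly F[1]} := 'X_0.
have hX : X \is 1.-homog by apply: mpolyX_linear.
have X0 : X != 0 by apply: mpolyX_neq0.
pose h := [tuple X * w%:MP; X * 1%:MP; 1%:MP].
pose g (c : nat -> F) := lpart (mpC 1 c) w%:MP 1%:MP + X * qpart (mpC 1 c) w%:MP 1%:MP.
have Fh c : conic (mpC 3 c) 'X_0 'X_1 'X_2 \mPo h = X * g c.
  by rewrite comp_conic !comp_mpolyXU /= /g /conic /lpart /qpart mpolyC1; ring.
have lh l : l \is 1.-homog -> lift l \mPo h = X * (l.@[pt2 w 1])%:MP.
  by move=> hl; rewrite comp2A !comp_mpolyXU /= (comp2_scale _ _ _ hl) comp2_const.
have Eh : E \mPo h = X ^+ size ls1 * (\prod_(l <- ls1) l.@[pt2 w 1])%:MP.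
  rewrite rmorph_prod /= big_seq.
  rewrite (eq_bigr (fun l : {mpoly F[2]} => X * (l.@[pt2 w 1])%:MP)); last first.
    by move=> l /lin1[hl _]; apply: lh.
  by rewrite -big_seq big_split /= big_const_seq count_predT iter_mulr_1 rmorph_prod.
have Ew : \prod_(l <- ls1) l.@[pt2 w 1] != 0.
  rewrite prodf_seq_neq0; apply/allP => l ll; apply: lw; by rewrite mem_cat ll.
have : divides (X ^+ d.+2) ((G \mPo h) * (E \mPo h)).
  rewrite -rmorphM -PGE [X in divides _ X](comp_implicit_form a b (Fh c1) (Fh c2)).
  rewrite (comp2_scale _ _ _ ha) (comp2_scale _ _ _ hb).
  exists ((a \mPo [tuple g c1; g c2]) * 1%:MP - (b \mPo [tuple g c1; g c2]) * w%:MP).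
  by rewrite [X ^+ d.+2]exprSr; ring.
have -> : d.+2 = (size ls1 + (d.+2 - size ls1).-1.+1)%N.
  by move: size_ls1 d_gt1; clear; lia.
rewrite exprD Eh mulrCA => /divides_cancel; rewrite expf_neq0 // => /(_ isT).
rewrite mulrC => /(divides_constM Ew); rewrite exprS => -[u uE].
have /mpoly1_divX : divides X (G \mPo h) by rewrite uE -mulrA; eexists.
rewrite comp_mpoly_meval => Gh; rewrite -[RHS]Gh; apply: meval_eq.
by apply: forall_ord3; rewrite (tnth_nth 0) /= /X ?mevalM ?mevalC ?mevalXU ?mul0r.
Qed.

(** * Birationality of the parametrization *)

Lemma row2_neq0 (t : 'rV[F]_2) : t != 0 -> (t 0 0, t 0 1) != (0, 0).
Proof.
apply: contraNneq => -[t0 t1]; apply/eqP/rowP => i; rewrite [RHS]mxE.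
by move: i; apply: forall_ord2.
Qed.

Lemma meval_map_at m n (p : {mpoly F[m]}) (f : m.-tuple {mpoly F[n]}) (x : 'rV[F]_n) :
  p.@[map_at f x 0] = (p \mPo f).@[x 0].
Proof. by rewrite comp_mpoly_meval; apply: meval_eq => i; rewrite mxE. Qed.

(** Pointwise form of [parametrization_eqmod]: [P = 0] says that [(a, b)] at [F(x)] is
    [r0 * (x 0, x 1)], and then [phi(F(x))] is [r0 ^+ 2 * D3(x)] times [x]. *)
Lemma fiber_point (x : 'I_3 -> F) : P.@[x] = 0 -> D3.@[x] != 0 ->
  (F1.@[x], F2.@[x]) != (0, 0) /\
  exists2 r, r != 0 & forall i, (tnth phi i).@[pt2 F1.@[x] F2.@[x]] = r * x i.
Proof.
have [_ _ nz] := ab.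
set t1 := F1.@[x]; set t2 := F2.@[x].
rewrite PE rmorphB !rmorphM /= !comp2_meval -/t1 -/t2 !mevalXU => /eqP.
rewrite subr_eq0 => /eqP abx Dx.
have t1E : t1 = conic c1 (x 0) (x 1) (x 2) by rewrite /t1 meval_conic !mevalXU.
have t2E : t2 = conic c2 (x 0) (x 1) (x 2) by rewrite /t2 meval_conic !mevalXU.
have DE : D3.@[x] = t1 * lpart c2 (x 0) (x 1) - t2 * lpart c1 (x 0) (x 1).
  by rewrite meval_cubic !mevalXU t1E t2E /conic /cubic; ring.
have t0 : (t1, t2) != (0, 0).
  by apply: contraNneq Dx => -[t10 t20]; rewrite DE t10 t20 !mul0r subrr.
have x0 : (x 0, x 1) != (0, 0).
  apply: contraNneq Dx => -[x0 x1]; rewrite DE x0 x1 /lpart; apply/eqP; ring.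
have [r0 [ra rb]] : exists r0, a.@[pt2 t1 t2] = r0 * x 0 /\ b.@[pt2 t1 t2] = r0 * x 1.
  apply: pt2_eq0 x0 => xi.
    exists (a.@[pt2 t1 t2] / x 0); rewrite divfK //; split=> //.
    by apply: (mulIf xi); rewrite -abx mulrAC divfK.
  exists (b.@[pt2 t1 t2] / x 1); rewrite divfK //; split=> //.
  by apply: (mulIf xi); rewrite abx mulrAC divfK.
have r00 : r0 != 0.
  by apply/eqP => r00; apply: (nz t1 t2 t0); rewrite ?ra ?rb r00 mul0r.
have lE : lamT.@[pt2 t1 t2] = r0 * D3.@[x].
  by rewrite meval_lam !mevalXU ra rb DE /lam /lpart /pt2 /=; ring.
have kE : kapT.@[pt2 t1 t2] = - (r0 ^+ 2 * D3.@[x] * x 2).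
  rewrite meval_kap !mevalXU ra rb meval_cubic !mevalXU /pt2 /= t1E t2E.
  by rewrite /kap /cubic /conic /lpart /qpart; ring.
split=> //; exists (r0 ^+ 2 * D3.@[x]); first by rewrite mulf_neq0 ?expf_neq0.
apply: forall_ord3; rewrite (tnth_nth 0) /= ?mevalN ?mevalM ?ra ?rb ?lE ?kE; ring.
Qed.

Lemma pencil_factor_neq0 : lamT * (D2 \mPo [tuple a; b]) != 0.
Proof.
have hD : D2 \is 3.-homog by apply: cubic_homog; apply: mpolyX_linear.
by rewrite mulf_neq0 // (coprime_forms_comp_neq0 ab hD D2_neq0).
Qed.

(** Dividing [phi] by its common factor [g] only rescales points. The composites are the identity
    off the lines [D3 = 0] on the curve, and where [H] is nonzero on the projective line, because
    [F] composed with [phi] is [H] times the variables. *)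
Lemma G_parameterizable : no_common_factor [:: F1; F2] -> parameterizable G F1 F2.
Proof.
move=> F12; have [ha hb _] := ab.
have hD2 : D2 \is 3.-homog by apply: cubic_homog; apply: mpolyX_linear.
have hD3 : D3 \is 3.-homog by apply: cubic_homog; apply: mpolyX_linear.
have hlam : lamT \is (1 + d.+1).-homog.
  by apply: rpredB; apply: dhomogM; by [apply: mpolyX_linear|apply: lpart_homog].
have hDab : D2 \mPo [tuple a; b] \is (d.+1 * 3).-homog.
  by apply: comp_dhomog hD2 _; apply: forall_ord2.
have [m hG] := G_homog.
have phi0 : exists i, tnth phi i != 0.
  exists 0; rewrite (tnth_nth 0) mulf_neq0 //.
  have := @coprime_forms_independent _ _ _ _ 1 0 ab.
  rewrite mpolyC1 mpolyC0 mul1r mul0r addr0; apply.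
  by rewrite xpair_eqE oner_eq0.
have [g [k [f [hf nz phiE]]]] := remove_common_zeros phi_homog phi0.
have g0 : g != 0.
  by have [i] := phi0; apply: contraNneq => g0; rewrite phiE g0 mul0r.
have Gf : G \mPo f = 0.
  have := G_on_phi; rewrite (comp_dhomogZ hG phiE) => /eqP.
  by rewrite mulf_eq0 expf_eq0 (negbTE g0) andbF => /eqP.
have f_curve (t : 'rV[F]_2) : t != 0 -> on_curve G (map_at f t).
  move=> t0; split; last by rewrite /vanishes_at meval_map_at Gf meval0.
  have [i] := nz _ _ (row2_neq0 t0); apply: contraNneq => /rowP/(_ i).
  by rewrite !mxE => ft0; rewrite -[X in _ == X]ft0; apply/eqP/meval_eq => j; rewrite -pt2_row.
split=> //; first by split; [apply: G_irreducible|exists m].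
  by exists 2%N; apply: forall_ord2; apply: conic_homog.
exists f; split=> //; first by exists k.
  exact: no_common_zero_factor hf nz.
pose row2 (x y : F) : 'rV[F]_2 := \row_i pt2 x y i.
have row2E (p : {mpoly F[2]}) x y : p.@[row2 x y 0] = p.@[pt2 x y].
  by apply: meval_eq => i; rewrite mxE.
have row2_1 x : row2 x 1 != 0.
  apply/eqP => /rowP/(_ 1); rewrite !mxE => /eqP.
  by rewrite oner_eq0.
split.
  exists 3%N, D3; split=> //.
    (* A point of the curve off these lines is found as the image of a general parameter. *)
    have D3f0 : D3 \mPo f != 0.
      have := mulf_neq0 (expf_neq0 2 lam_neq0) pencil_factor_neq0.
      have -> : lamT ^+ 2 * (lamT * (D2 \mPo [tuple a; b])) = D3 \mPo phi.
        rewrite D3_comp comp2A !comp_mpolyXU /= ![_ * lamT]mulrC (comp2_scale _ _ _ hD2).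
        by rewrite mulrA -exprSr.
      rewrite (comp_dhomogZ hD3 phiE).
      by apply: contraNneq => ->; rewrite mulr0.
    have [x xf] := binary_form_nonroot (comp_dhomog hD3 hf) D3f0.
    exists (map_at f (row2 x 1)); first exact: f_curve.
    by rewrite /vanishes_at meval_map_at row2E; apply/eqP.
  move=> x [x0 Gx] /eqP Dx.
  have Px : P.@[x 0] = 0 by rewrite PGE rmorphM /= [G.@[_]]Gx mul0r.
  have [t0 [r r0 phix]] := fiber_point Px Dx.
  have psiE : map_at [tuple F1; F2] x 0 =1 pt2 F1.@[x 0] F2.@[x 0].
    by apply: forall_ord2; rewrite mxE (tnth_nth 0).
  have psi0 : map_at [tuple F1; F2] x != 0.
    apply: contraNneq t0 => psi0.
    have := psiE 0; have := psiE 1; rewrite psi0 !mxE /pt2 /= => <- <-.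
    by [].
  split=> //; split=> //; first by have [] := f_curve _ psi0.
  have fx i : g.@[pt2 F1.@[x 0] F2.@[x 0]] * map_at f (map_at [tuple F1; F2] x) 0 i = r * x 0 i.
    by rewrite -phix phiE rmorphM /= mxE (meval_eq _ psiE).
  have gx : g.@[pt2 F1.@[x 0] F2.@[x 0]] != 0.
    apply: contraNneq x0 => gx; apply/eqP/rowP => i; rewrite [RHS]mxE.
    by apply: (mulfI r0); rewrite -fx gx mul0r mulr0.
  exists (r / g.@[pt2 F1.@[x 0] F2.@[x 0]]); apply/rowP => i; rewrite [RHS]mxE.
  by apply: (mulfI gx); rewrite fx mulrA [_ * (r / _)]mulrC divfK.
set H := lamT * (D2 \mPo [tuple a; b]).
have hH : H \is (1 + d.+1 + d.+1 * 3).-homog by apply: dhomogM.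
exists (1 + d.+1 + d.+1 * 3)%N, H; split=> //.
  have [x Hx] := binary_form_nonroot hH pencil_factor_neq0.
  by exists (row2 x 1) => //; rewrite /vanishes_at row2E; apply/eqP.
move=> t t0 /eqP Ht; split; first exact: f_curve.
have psi_f i : g.@[t 0] ^+ 2 * map_at [tuple F1; F2] (map_at f t) 0 i = H.@[t 0] * t 0 i.
  have Fi (Q : {mpoly F[3]}) (y : {mpoly F[2]}) : Q \is 2.-homog -> Q \mPo phi = y * H ->
      g.@[t 0] ^+ 2 * Q.@[map_at f t 0] = H.@[t 0] * y.@[t 0].
    move=> hQ; rewrite (comp_dhomogZ hQ phiE) => QE.
    have := congr1 (meval (t 0)) QE; rewrite expr2 !mevalM => QtE.
    by rewrite meval_map_at expr2 QtE mulrC.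
  rewrite mxE; move: i; apply: forall_ord2; rewrite (tnth_nth 0) /=.
    by rewrite (Fi _ 'X_0 (conic_homog _) F1_on_phi) mevalXU.
  by rewrite (Fi _ 'X_1 (conic_homog _) F2_on_phi) mevalXU.
have gt : g.@[t 0] != 0.
  apply: contraNneq t0 => gt; apply/eqP/rowP => i; rewrite [RHS]mxE.
  by apply: (mulfI Ht); rewrite -psi_f gt expr0n mul0r mulr0.
have psi_ft : map_at [tuple F1; F2] (map_at f t) = (H.@[t 0] / g.@[t 0] ^+ 2) *: t.
  apply/rowP => i; rewrite [RHS]mxE; apply: (mulfI (expf_neq0 2 gt)).
  by rewrite psi_f mulrA [_ * (_ / _)]mulrC divfK // expf_neq0.
split=> //; last by exists (H.@[t 0] / g.@[t 0] ^+ 2).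
rewrite psi_ft scaler_eq0 negb_or t0 andbT.
by rewrite mulf_neq0 ?invr_neq0 ?expf_neq0.
Qed.

End RationalCurve.

(** * From the hypotheses on the conics to the normal form *)

Lemma conic_through_001 (K : fieldType) (Q : {mpoly K[3]}) :
  Q \is 2.-homog -> Q.@[@delta_mx K 1 3 0 2 0] = 0 ->
  exists c, Q = conic (mpC 3 c) 'X_0 'X_1 'X_2.
Proof.
move=> /dhomogS_sum[f hf ->].
have [k0 f0] := linear_formE (hf 0).
have [k1 f1] := linear_formE (hf 1).
have [k2 f2] := linear_formE (hf 2).
have o1 : lift ord0 ord0 = 1 :> 'I_3 by apply: val_inj.
have o2 : lift ord0 (lift ord0 ord0) = 2 :> 'I_3 by apply: val_inj.
have sum3 (A : nmodType) (h : 'I_3 -> A) : \sum_i h i = h 0 + h 1 + h 2.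
  by rewrite !big_ord_recl big_ord0 addr0 addrA o2 o1.
rewrite sum3 f0 f1 f2 !sum3 => Q001.
(* Coefficients in the order of [lpart] and [qpart]: those of ['X_0 * 'X_2], ['X_1 * 'X_2],
   ['X_0 ^+ 2], ['X_0 * 'X_1], ['X_1 ^+ 2]. The one of ['X_2 ^+ 2] is the value at (0 : 0 : 1). *)
pose c := nth 0 [:: k0 2 + k2 0; k1 2 + k2 1; k0 0; k0 1 + k1 0; k1 1].
have k22 : k2 2 = 0.
  move: Q001; rewrite !(rmorphD, rmorphM) /= !mevalC !mevalXU !mxE /=.
  by rewrite !(mul0r, mulr0, add0r, mulr1, mul1r).
exists c; rewrite k22 mpolyC0 /conic /lpart /qpart /mpC /c /= !mpolyCD.
ring.
Qed.

Lemma degenerate_binary (L : closedFieldType) (p : {mpoly L[2]}) :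
  p \is 2.-homog -> degenerate_conic (p \mPo [tuple 'X_0; 'X_1 : {mpoly L[3]}]).
Proof.
move=> hp; have [->|p0] := eqVneq p 0.
  by exists 0, 0; rewrite comp_mpoly0 mulr0; split=> //; apply: rpred0.
have [c [ls [_ size_ls -> hls]]] := binary_form_split hp p0.
case: ls size_ls hls => [|l1 [|l2 []]] // _ hls.
have [hl1 _] := hls l1 (mem_head _ _).
have [hl2 _] := hls l2 (mem_last l1 [:: l2]).
exists ((c%:MP * l1) \mPo [tuple 'X_0; 'X_1]), (l2 \mPo [tuple 'X_0; 'X_1]).
split; [|exact: lift_homog|by rewrite !big_cons big_nil mulr1 mulrA rmorphM].
by apply: lift_homog; rewrite mul_mpolyC; apply: rpredZ.
Qed.

(** If ['X_2] occurs in neither conic, the pencil conic is a binary quadratic form over [L] and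
    splits. The coefficients are paired by variable because these pairs are the coefficients of [a]
    and [b] in [lam]. *)
Lemma nondegenerate_lpart (K L : closedFieldType)
    (iota : {rmorphism {fraction {mpoly K[2]}} -> L}) (c1 c2 : nat -> K) :
  ~ degenerate_conic (pencil_conic iota (conic (mpC 3 c1) 'X_0 'X_1 'X_2)
                                        (conic (mpC 3 c2) 'X_0 'X_1 'X_2)) ->
  (c1 0%N, c2 0%N) != (0, 0) \/ (c1 1%N, c2 1%N) != (0, 0).
Proof.
move=> nd; have [] := boolP ((c1 0%N, c2 0%N) != (0, 0)); first by left.
rewrite negbK => /eqP[c10 c20]; right; apply/negP => /eqP[c11 c21]; apply: nd.
pose f : {rmorphism K -> L} := iota \o @tofrac _ \o @mpolyC 2 K.
have base c : pencil_base_change iota (conic (mpC 3 c) 'X_0 'X_1 'X_2) =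
    conic (mpC 3 (f \o c)) 'X_0 'X_1 'X_2.
  rewrite -[pencil_base_change iota]/(map_mpoly f).
  by rewrite !(rmorphD, rmorphM, rmorphXn) /= !map_mpolyC !map_mpolyX.
pose q c : {mpoly L[2]} := qpart (mpC 2 (f \o c)) 'X_0 'X_1.
have hq c : q c \is 2.-homog by apply: (@qpart_homog _ _ _ _ _ 1); apply: mpolyX_linear.
have -> : pencil_conic iota (conic (mpC 3 c1) 'X_0 'X_1 'X_2)
      (conic (mpC 3 c2) 'X_0 'X_1 'X_2) =
    (pencil_T iota 0 *: q c2 - pencil_T iota 1 *: q c1) \mPo [tuple 'X_0; 'X_1].
  rewrite /pencil_conic !base linearB !linearZ /= /q.
  rewrite /conic /lpart /qpart /mpC /= c10 c20 c11 c21 !rmorph0 !mul0r !addr0 !mulr0 !add0r.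
  by rewrite !(rmorphD, rmorphM, rmorphXn) /= !comp_mpolyC !comp_mpolyXU.
by apply: degenerate_binary; apply: rpredB; apply/rpredZ/hq.
Qed.

(** Both parts of a conic vanish at [(v1, v2)] when the line in that direction through (0 : 0 : 1)
    is a component; for both conics it would be a common factor. *)
Lemma coprime_base_free (K : closedFieldType) (c1 c2 : nat -> K) :
  no_common_factor [:: conic (mpC 3 c1) 'X_0 'X_1 'X_2;
                       conic (mpC 3 c2) 'X_0 'X_1 'X_2] ->
  forall v1 v2 : K, (v1, v2) != (0, 0) ->
  (lpart c1 v1 v2, qpart c1 v1 v2) != (0, 0) \/
  (lpart c2 v1 v2, qpart c2 v1 v2) != (0, 0).
Proof.
move=> F12 v1 v2 v0.
have [] := boolP ((lpart c1 v1 v2, qpart c1 v1 v2) != (0, 0)); first by left.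
rewrite negbK => /eqP[l1 q1]; right; apply/negP => /eqP[l2 q2].
pose n : {mpoly K[3]} := line_through v1 v2 \mPo [tuple 'X_0; 'X_1].
have hn : n \is 1.-homog by apply/lift_homog/line_through_homog.
have dvd c : lpart c v1 v2 = 0 -> qpart c v1 v2 = 0 ->
    divides n (conic (mpC 3 c) 'X_0 'X_1 'X_2).
  move=> lv qv.
  have lift_dvd d (p : {mpoly K[2]}) : p \is d.+1.-homog -> p.@[pt2 v1 v2] = 0 ->
      divides n (p \mPo [tuple 'X_0; 'X_1]).
    move=> hp pv; have [q _ ->] := binary_form_factor hp v0 pv.
    by exists (q \mPo [tuple 'X_0; 'X_1]); rewrite rmorphM.
  have h0 := mpolyX_linear K (0 : 'I_2); have h1 := mpolyX_linear K (1 : 'I_2).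
  apply: dividesD; first apply: dividesMl.
    have := lift_dvd 0%N _ (lpart_homog c h0 h1).
    rewrite !(rmorphD, rmorphM) /= !mevalC !mevalXU !comp_mpolyC !comp_mpolyXU.
    exact.
  have := lift_dvd 1%N _ (qpart_homog c h0 h1).
  rewrite !(rmorphD, rmorphM, rmorphXn) /= !mevalC !mevalXU !comp_mpolyC !comp_mpolyXU.
  exact.
have := F12 n; rewrite (negbTE (dhomogS_nunit hn)) => /(_ _)/notF; apply.
by move=> p; rewrite !inE => /orP[] /eqP->; apply: dvd.
Qed.

(** A zero cubic means [l2 * F1 = l1 * F2]. If the prime [l1] divides [l2], then [F1] divides [F2].
    If it divides [F1], then [F1 = l1 * f] and [F2 = l2 * f], where [f] must be a unit, against the
    degree of [F1]. *)
Lemma coprime_cubic_neq0 (K : closedFieldType) (c1 c2 : nat -> K) :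
  no_common_factor [:: conic (mpC 3 c1) 'X_0 'X_1 'X_2;
                       conic (mpC 3 c2) 'X_0 'X_1 'X_2] ->
  (c1 0%N, c2 0%N) != (0, 0) \/ (c1 1%N, c2 1%N) != (0, 0) ->
  cubic (mpC 2 c1) (mpC 2 c2) 'X_0 'X_1 != 0.
Proof.
move=> F12 c0; apply/eqP => D0.
pose F1 := conic (mpC 3 c1) 'X_0 'X_1 'X_2; pose F2 := conic (mpC 3 c2) 'X_0 'X_1 'X_2.
pose l1 : {mpoly K[3]} := lpart (mpC 3 c1) 'X_0 'X_1.
pose l2 : {mpoly K[3]} := lpart (mpC 3 c2) 'X_0 'X_1.
have hl1 : l1 \is 1.-homog by apply: lpart_homog; apply: mpolyX_linear.
have hF1 : F1 \is 2.-homog by apply: conic_homog.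
have hF2 : F2 \is 2.-homog by apply: conic_homog.
have nunit d (p : {mpoly K[3]}) : p \is d.+1.-homog -> divides p F1 -> divides p F2 -> False.
  move=> hp p1 p2; have := dhomogS_nunit hp; rewrite F12 // => q.
  by rewrite !inE => /orP[] /eqP->.
have E : l2 * F1 = l1 * F2.
  have D3 := cubic_pencil c1 c2; rewrite (D3_comp c1 c2) D0 comp_mpoly0 in D3.
  by apply/eqP; rewrite -subr_eq0 ![_ * F1]mulrC ![_ * F2]mulrC; apply/eqP.
have [l10|l10] := eqVneq l1 0.
  move: E; rewrite l10 mul0r => /eqP; rewrite mulf_eq0 => /orP[/eqP l20|/eqP F10].
    have coef c : lpart (mpC 3 c) 'X_0 'X_1 = 0 :> {mpoly K[3]} -> c 0%N = 0 /\ c 1%N = 0.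
      move=> lc0; split.
        have := congr1 (meval (fun i : 'I_3 => if i == 0 then 1 else 0)) lc0.
        by rewrite meval0 rmorphD !rmorphM /= !mevalC !mevalXU /= mulr1 mulr0 addr0.
      have := congr1 (meval (fun i : 'I_3 => if i == 1 then 1 else 0)) lc0.
      by rewrite meval0 rmorphD !rmorphM /= !mevalC !mevalXU /= mulr1 mulr0 add0r.
    have [a0 a1] := coef c1 l10; have [b0 b1] := coef c2 l20.
    by move: c0; rewrite a0 a1 b0 b1 eqxx; case.
  exact: (nunit _ _ hF2 (eq_ind_r (divides F2) (divides0 F2) F10) (divides_refl F2)).
have l1P := linear_form_prime hl1 l10.
have [[g l2E]|[f F1E]] : divides l1 l2 \/ divides l1 F1 by apply: l1P; exists F2.
  apply: (nunit _ _ hF1) (divides_refl _) _; exists g.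
  by apply: (mulfI l10); rewrite -E l2E; ring.
have F2E : F2 = f * l2 by apply: (mulfI l10); rewrite -E F1E; ring.
have [F10|F10] := eqVneq F1 0.
  exact: (nunit _ _ hF2 (eq_ind_r (divides F2) (divides0 F2) F10) (divides_refl F2)).
have f0 : f != 0 by apply: contraNneq F10 => f0; rewrite F1E f0 mulr0.
have fU : f \is a GRing.unit.
  apply: F12 => q; rewrite !inE => /orP[] /eqP->.
    by exists l1; rewrite -/F1 F1E mulrC.
  by exists l2.
have := msize_dhomog F10 hF1; rewrite F1E msizeM // (msize_dhomog l10 hl1).
by move: fU; rewrite mpoly_unit_msize => /eqP->.
Qed.

(** The form is [a * m 0 + b * m 1] with [m i] zero or linear. If it vanished, [b], sharing no
    linear factor with [a], would divide [m 0]; its degree is at least 2, so [m 0] and then [m 1]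
    would be zero. *)
Lemma coprime_forms_lam_neq0 (K : closedFieldType) d (a b : {mpoly K[2]}) (c1 c2 : nat -> K) :
  coprime_forms d a b -> (0 < d)%N ->
  (c1 0%N, c2 0%N) != (0, 0) \/ (c1 1%N, c2 1%N) != (0, 0) ->
  lam (mpC 2 c1) (mpC 2 c2) 'X_0 'X_1 a b != 0.
Proof.
move=> hab d0 c0; have [ha hb nz] := hab; apply/eqP => l0.
pose m i : {mpoly K[2]} := line_through (c1 i) (c2 i).
have E : a * m 0%N + b * m 1%N = 0.
  by rewrite -[RHS]l0 /m /line_through /lam /lpart /mpC; ring.
have a0 : a != 0.
  have := @coprime_forms_independent _ _ _ _ 1 0 hab.
  rewrite mpolyC1 mpolyC0 mul1r mul0r addr0; apply.
  by rewrite xpair_eqE oner_eq0.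
have b0 : b != 0.
  have := @coprime_forms_independent _ _ _ _ 0 1 hab.
  rewrite mpolyC1 mpolyC0 mul1r mul0r add0r; apply.
  by rewrite xpair_eqE oner_eq0 andbF.
have [ca [la [ca0 _ aE hla]]] := binary_form_split ha a0.
have bm : divides b (m 0%N).
  apply: (@divides_coprime_prod _ _ _ la) => [l ll|].
    have [hl ln0] := hla l ll; split=> //; first exact: linear_form_prime.
    have [x [y [xy lxy]]] := binary_form_root hl.
    move=> [q bE]; apply: (nz x y xy); last by rewrite bE mevalM lxy mul0r.
    by rewrite aE (big_rem l) //= !mevalM lxy mul0r mulr0.
  apply: (divides_constM ca0); rewrite mulrA -aE.
  by exists (- m 1%N); apply/eqP; rewrite mulrN -addr_eq0 E.
have m0 : m 0%N = 0.
  apply/eqP; apply: contraTT d0 => m0; rewrite -leqNgt.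
  have := msize_divides m0 bm; rewrite (msize_dhomog b0 hb).
  by rewrite (msize_dhomog m0 (line_through_homog _ _)).
have m1 : m 1%N = 0.
  by move/eqP: E; rewrite m0 mulr0 add0r mulf_eq0 (negbTE b0) => /eqP.
by case: c0 => /line_through_neq0; rewrite -/(m _) ?m0 ?m1 eqxx.
Qed.

Unset Implicit Arguments.

Theorem theorem2p9 (K : closedFieldType)
    (L : closedFieldType) (iota : {rmorphism {fraction {mpoly K[2]}} -> L})
    (HL : is_algebraic_closure iota)
    (F1 F2 : {mpoly K[3]})
    (HF1 : F1 \is 2.-homog) (HF2 : F2 \is 2.-homog)
    (HF : no_common_factor [:: F1; F2])
    (HF001 : base_point F1 F2 point001)
    (Hconic : ~ degenerate_conic (pencil_conic iota F1 F2))
    (d0 : nat) (Hd0 : (2 < d0)%N)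
    (a b : {mpoly K[2]})
    (Ha : a \is d0.-homog) (Hb : b \is d0.-homog)
    (Hab : no_common_factor [:: a; b]) :
  let P := implicit_form a b F1 F2 in
  exists G E : {mpoly K[3]},
    [/\ (irreducible_elt P /\ G = P) \/
          (~ irreducible_elt P /\ unique_nonlinear_factor P G),
        P = G * E,
        [/\ rational_curve G, parameterizable G F1 F2 &
            on_curve G point001],
        exists (c : K) (ls : seq {mpoly K[3]}),
          [/\ c != 0, E = c *: \prod_(l <- ls) l &
              forall l, l \in ls ->
                [/\ linear_form l, l != 0 &
                    exists2 x, base_point F1 F2 x & vanishes_at l x]] &
        ((msize E).-1 <= 3)%N].
Proof.
move=> P; have [p001 F1_001 F2_001] := HF001.
case: d0 Hd0 Ha Hb => // d Hd Ha Hb.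
have hab : coprime_forms d a b by split=> //; apply: no_common_factor_zero Ha Hb Hab.
have [c1 F1E] := conic_through_001 HF1 F1_001.
have [c2 F2E] := conic_through_001 HF2 F2_001.
subst F1 F2.
have c0 := nondegenerate_lpart Hconic.
have D0 := coprime_cubic_neq0 HF c0.
have l0 : lam (mpC 2 c1) (mpC 2 c2) 'X_0 'X_1 a b != 0.
  exact: coprime_forms_lam_neq0 hab (ltnW Hd) c0.
have bf := coprime_base_free HF.
have [k [ls1 [ls2 [G [[k0 DE ls3] [lin PGE linG]]]]]] := factorization hab D0 bf.
exists G, (\prod_(l <- ls1) (l \mPo [tuple 'X_0; 'X_1])).
have Girr : irreducible_elt G.
  exact: (G_irreducible hab Hd D0 l0 k0 DE ls3 lin PGE linG).
have E0 : \prod_(l <- ls1) (l \mPo [tuple 'X_0; 'X_1 : {mpoly K[3]}]) != 0.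
  exact: (E_neq0 hab D0 l0 PGE).
have hE := E_homog lin.
have Gpar : parameterizable G _ _ := G_parameterizable hab Hd D0 l0 k0 DE ls3 lin PGE linG HF.
split=> //.
- have [_ GU _] := Girr.
  (* Without removed lines [P] is [G]; otherwise their product has positive degree and [P] is
     reducible. *)
  case: (posnP (size ls1)) => [/size0nil ls10|ls1_gt0].
    by left; rewrite /P PGE ls10 big_nil mulr1.
  right; split.
    move=> [_ _ /(_ _ _ PGE)[GU'|]]; first by rewrite GU' in GU.
    by rewrite mpoly_unit_msize (msize_dhomog E0 hE) eqSS eqn0Ngt ls1_gt0.
  split=> //; first by eexists; apply: PGE.
    by rewrite (msize_G hab D0 l0 lin PGE); move: (size_ls1 ls3) Hd; clear; lia.
  exact: (G_unique_nonlinear hab Hd D0 l0 k0 DE ls3 lin PGE linG).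
- split=> //.
    have [curveG hF _ [phi [hphi _ _ bir]]] := Gpar.
    split=> //; exists [tuple conic (mpC 3 c1) 'X_0 'X_1 'X_2; conic (mpC 3 c2) 'X_0 'X_1 'X_2], phi; split; [exact: hF|exact: hphi|exact: bir].
  split=> //; rewrite /vanishes_at -(G_through_001 hab Hd D0 DE ls3 lin PGE).
  by apply: meval_eq => i; rewrite mxE eqxx; case: eqP.
- exists 1, [seq l \mPo [tuple 'X_0; 'X_1] | l <- ls1].
  rewrite scale1r big_map; split=> // [|n /mapP[l ll ->]]; first exact: oner_neq0.
  have [hl ln0] := lin1 lin ll; split; [exact: lift_homog|exact: lift_neq0|].
  (* The lines come from binary forms, so (0 : 0 : 1) is the base point on each of them. Its first
     two coordinates are zero, and [meval_dhomogZ] with the scalar 0 gives the value there. *)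
  exists point001 => //; rewrite /vanishes_at comp2_meval !mevalXU !mxE /=.
  by have := meval_dhomogZ hl (fun i : 'I_2 => esym (mul0r (pt2 1 1 i)));
    rewrite expr1 mul0r => lz; rewrite -[RHS]lz; apply: meval_eq; apply: forall_ord2.
by rewrite (msize_dhomog E0 hE) /=; apply: (size_ls1 ls3).
Qed.
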